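(* Consider the two-user Gaussian multiple-access wiretap channel with degraded message sets and no feedback described in the context, with power constraints $P_1,P_2>0$ and noise variances $\sigma_1^2,\sigma_2^2>0$. Its secrecy capacity region $\mathcal{C}_{s,gmac-dms}$ satisfies $\mathcal{C}_{s,gmac-dms}\subseteq\mathcal{C}^{out}_{s,gmac-dms}$, where \[ \mathcal{C}^{out}_{s,gmac-dms}=\bigcup_{-1\le\rho\le1}\Big\{(R_1\ge0,R_2\ge0):\ R_2\le\tfrac12\log\Big(1+\tfrac{(1-\rho^2)P_2}{\sigma_1^2}\Big), \] \[ R_1+R_2\le\tfrac12\log\Big(1+\tfrac{P_1+P_2+2\sqrt{P_1P_2}\rho}{\sigma_1^2}\Big)-\tfrac12\log\Big(1+\tfrac{P_1+P_2+2\sqrt{P_1P_2}\rho}{\sigma_1^2+\sigma_2^2}\Big)\Big\}. \]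
   Context: All logarithms are base 2. Channel (GMAC-WT-DMS without feedback): for $i=1,\dots,N$, $Y_i=X_{1,i}+X_{2,i}+\eta_{1,i}$ and $Z_i=Y_i+\eta_{2,i}$, where $\eta_{1,i}\sim\mathcal N(0,\sigma_1^2)$, $\eta_{2,i}\sim\mathcal N(0,\sigma_2^2)$ are i.i.d. over $i$, mutually independent, and independent of the messages. Messages $W_1,W_2$ are independent, $W_j$ uniform on $\{1,\dots,|\mathcal W_j|\}$. $X_{1,i}$ is a (possibly stochastic) function of $W_1$ only; $X_{2,i}$ is a (possibly stochastic) function of $(W_1,W_2)$ only. Power constraints: $\frac1N\sum_{i=1}^N E[X_{j,i}^2]\le P_j$. The receiver outputs $(\hat W_1,\hat W_2)=\psi(Y^N)$; $P_e$ is the average probability that $\psi(Y^N)\neq(W_1,W_2)$. Equivocation $\Delta=\frac1N H(W_1,W_2\mid Z^N)$. A pair $(R_1,R_2)$ is achievable with perfect weak secrecy if for every $\epsilon>0$ and all sufficiently large $N$ there exist encoders and a decoder with $\frac{\log|\mathcal W_j|}{N}=R_j$ ($j=1,2$), $\Delta\ge R_1+R_2-\epsilon$ and $P_e\le\epsilon$. $\mathcal{C}_{s,gmac-dms}$ is the set of all such pairs. *)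

(* Defs.v *)
From HB Require Import structures.
From mathcomp Require Import all_boot all_order all_algebra.
From mathcomp Require Import all_classical all_reals all_analysis.
Set Implicit Arguments.
Unset Strict Implicit.
Unset Printing Implicit Defensive.
Import Order.TTheory GRing.Theory Num.Theory.
Import numFieldNormedType.Exports.
Local Open Scope classical_set_scope.
Local Open Scope ring_scope.

Definition log2 {R : realType} (x : R) : R := ln x / ln 2.

Section defs.
Context {R : realType}.

Definition rv_events d (Om : measurableType d) d' (T : measurableType d')
  (X : Om -> T) : set (set Om) := [set X @^-1` B | B in measurable].

Definition fin_events d (Om : measurableType d) (F : finType) (X : Om -> F)
  : set (set Om) := [set X @^-1` B | B in [set: set F]].

Definition mutually_independent d (Om : measurableType d)
  (P : probability Om R) (I : finType) (E : I -> set (set Om)) : Prop :=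
  forall A : I -> set Om, (forall i, E i (A i)) ->
    fine (P (\bigcap_(i in [set: I]) A i)) = \prod_(i : I) fine (P (A i)).

Definition disc_cond_entropy d (Om : measurableType d) (P : probability Om R)
  (F G : finType) (A : Om -> F) (V : Om -> G) : R :=
  - \sum_(a : F) \sum_(v : G)
      let pj := fine (P [set w | A w = a /\ V w = v]) in
      let pv := fine (P [set w | V w = v]) in
      if pj == 0 then 0 else pj * log2 (pj / pv).

(** Conditional entropy H(A | Z) of a finite-valued random variable A given a
    real random vector Z, defined (Dobrushin/Pinsker) as the infimum over all
    finite Borel quantizations g of Z of the discrete H(A | g(Z)). *)
Definition cond_entropy d (Om : measurableType d) (P : probability Om R)
  (F : finType) (n : nat) (A : Om -> F) (Z : Om -> n.-tuple R) : \bar R :=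
  ereal_inf [set x | exists (k : nat) (g : n.-tuple R -> 'I_k),
     (forall j, measurable (g @^-1` [set j])) /\
     x = (disc_cond_entropy P A (g \o Z))%:E].

(** A code of block length N with message set sizes M1, M2 for the
    GMAC-WT-DMS (power constraints P1, P2, noise standard deviations s1, s2),
    realised on some probability space, with average error probability at
    most eps and normalized equivocation at least R1 + R2 - eps.
    Encoder 1 is X1^N = f1 W1 U1 and encoder 2 is X2^N = f2 (W1,W2) U2, where
    U1, U2 are the private randomness of the (stochastic) encoders. *)
Definition gmac_dms_code (P1 P2 s1 s2 : R) (N M1 M2 : nat) (R1 R2 eps : R)
  : Prop :=
  exists d (Om : measurableType d) (P : probability Om R)
    d1 (T1 : measurableType d1) d2 (T2 : measurableType d2)
    (f1 : 'I_M1 -> T1 -> N.-tuple R)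
    (f2 : 'I_M1 * 'I_M2 -> T2 -> N.-tuple R)
    (psi : N.-tuple R -> 'I_M1 * 'I_M2)
    (W1 : Om -> 'I_M1) (W2 : Om -> 'I_M2) (U1 : Om -> T1) (U2 : Om -> T2)
    (eta1 eta2 : 'I_N -> Om -> R),
    let X1 w := f1 (W1 w) (U1 w) in
    let X2 w := f2 (W1 w, W2 w) (U2 w) in
    let Y w := [tuple tnth (X1 w) i + tnth (X2 w) i + eta1 i w | i < N] in
    let Z w := [tuple tnth (Y w) i + eta2 i w | i < N] in
    [/\
        (forall k, measurable (W1 @^-1` [set k])) /\
        (forall k, measurable (W2 @^-1` [set k])) /\
        (forall k, P (W1 @^-1` [set k]) = (M1%:R^-1)%:E) /\
        (forall k, P (W2 @^-1` [set k]) = (M2%:R^-1)%:E),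
        [/\ measurable_fun setT U1, measurable_fun setT U2,
            (forall k, measurable_fun setT (f1 k)) &
            (forall k, measurable_fun setT (f2 k))],
        (forall i, measurable_fun setT (eta1 i) /\ measurable_fun setT (eta2 i))
        /\ (forall i B, measurable B ->
              P (eta1 i @^-1` B) = normal_prob 0 s1 B /\
              P (eta2 i @^-1` B) = normal_prob 0 s2 B),
        mutually_independent P
          (fun i : ('I_4 + ('I_N + 'I_N))%type =>
             match i with
             | inl k => nth set0 [:: fin_events W1; fin_events W2;
                                     rv_events U1; rv_events U2] k
             | inr (inl j) => rv_events (eta1 j)
             | inr (inr j) => rv_events (eta2 j)
             end) &
     [/\
        (forall m, measurable (psi @^-1` [set m])),
        (N%:R^-1)%:E * (\sum_(i < N) \int[P]_w ((tnth (X1 w) i) ^+ 2)%:E)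
          <= P1%:E /\
        (N%:R^-1)%:E * (\sum_(i < N) \int[P]_w ((tnth (X2 w) i) ^+ 2)%:E)
          <= P2%:E,
        P [set w | psi (Y w) <> (W1 w, W2 w)] <= eps%:E &
        (N%:R^-1)%:E * cond_entropy P (fun w => (W1 w, W2 w)) Z
          >= (R1 + R2 - eps)%:E]]%E.

Definition achievable_gmac_dms (P1 P2 s1 s2 : R) (R1 R2 : R) : Prop :=
  forall eps : R, 0 < eps -> exists N0 : nat, forall N : nat, (N0 <= N)%N ->
    exists M1 M2 : nat, [/\ (0 < M1)%N, (0 < M2)%N,
      log2 (M1%:R : R) / N%:R = R1, log2 (M2%:R : R) / N%:R = R2 &
      gmac_dms_code P1 P2 s1 s2 N M1 M2 R1 R2 eps].

Definition gmac_dms_outer (P1 P2 s1 s2 : R) (R1 R2 : R) : Prop :=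
  exists rho : R, [/\ -1 <= rho <= 1, 0 <= R1, 0 <= R2,
    R2 <= 2^-1 * log2 (1 + (1 - rho ^+ 2) * P2 / s1 ^+ 2) &
    R1 + R2 <=
      2^-1 * log2 (1 + (P1 + P2 + 2 * Num.sqrt (P1 * P2) * rho) / s1 ^+ 2)
      - 2^-1 * log2 (1 + (P1 + P2 + 2 * Num.sqrt (P1 * P2) * rho)
                           / (s1 ^+ 2 + s2 ^+ 2))].

End defs.

(* Main.v *)
(** The converse is proved by a change of measure, without densities of the
    outputs, differential entropies or the entropy power inequality.

    Replace the channel by a Gaussian test channel whose likelihood ratio with
    respect to the true one is [expR (- L)], where [L] is a quadratic form in the
    inputs and the noise. From [ln u <= u - 1], any [T >= 1] on the probability
    space satisfies [E (ln T) <= E L + E (T * expR (- L)) - 1], and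
    [E (T * expR (- L))] is an expectation under the test channel.

    - For [R2], the test output is [(1 + g) X1 + noise] with [g = c / P1], where
      [c] is the average of [E (X1 X2)]; it does not depend on [W2], so [W2] is
      decoded correctly with probability at most [1 / M2], and one takes
      [T = M2] on correct decoding.
    - For [R1 + R2], the test channel draws [Z = X1 + X2 + noise] and then [Y]
      from [Z] by a linear Gaussian estimate, so that [W - Z - Y] holds and the
      decoder's output has a posterior [q (. | Z)] which only depends on [Z]. A
      finite quantization of [q] is a cross-entropy bound for the equivocation,
      and one takes [T = 1 / q] on correct decoding.

    Since the same test channel is used at all times, [E L] only depends on the
    averages of [E (X1 ^ 2)], [E (X2 ^ 2)] and [E (X1 X2)]; with
    [rho = c / sqrt (P1 P2)] both bounds are those of the outer region up to
    terms vanishing with the error and [1 / N]. A common [rho] is obtained by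
    maximizing the slack over [-1, 1]. *)
Require Import Defs.
From HB Require Import structures.
From mathcomp Require Import all_boot all_order all_algebra.
From mathcomp Require Import all_classical all_reals all_analysis.
From mathcomp Require Import measurable_realfun ring lra.
Set Implicit Arguments.
Unset Strict Implicit.
Unset Printing Implicit Defensive.
Import Order.TTheory GRing.Theory Num.Theory.
Import numFieldNormedType.Exports.
Local Open Scope classical_set_scope.
Local Open Scope ring_scope.


(** * Integration against Gaussian laws *)

Section gaussian_integrals.
Context {R : realType}.
Local Notation mu := (@lebesgue_measure R).
Local Open Scope ereal_scope.
Import HBNNSimple.

(** Monotone convergence along simple functions, applied on both sides, reduces the claim to
    indicators, where it is the hypothesis on [nu]. *)
Lemma ge0_integral_density d (T : measurableType d)
    (m nu : {measure set T -> \bar R}) (p : T -> R) (f : T -> \bar R) :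
  measurable_fun setT p -> (forall x, 0 <= p x)%R ->
  (forall A, measurable A -> nu A = \int[m]_(x in A) (p x)%:E) ->
  measurable_fun setT f -> (forall x, 0 <= f x) ->
  \int[nu]_x f x = \int[m]_x (f x * (p x)%:E).
Proof.
move=> mp p0 nuE mf f0; pose f_ := nnsfun_approx measurableT mf.
have mpE : measurable_fun setT (EFin \o p) by exact/measurable_EFinP.
transitivity (limn (fun n => \int[nu]_x (f_ n x)%:E)).
  rewrite -monotone_convergence//.
  - apply: eq_integral => x _; apply/esym/cvg_lim => //.
    exact: cvg_nnsfun_approx.
  - by move=> n; exact/measurable_EFinP/measurable_funP.
  - by move=> n y _; rewrite lee_fin.
  - by move=> y _ a b ab; rewrite lee_fin; exact/lefP/nd_nnsfun_approx.
transitivity (limn (fun n => \int[m]_x ((f_ n x)%:E * (p x)%:E))); last first.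
  rewrite -monotone_convergence//.
  - apply: eq_integral => x _; apply/cvg_lim => //.
    by apply: cvgeMr => //; exact: cvg_nnsfun_approx.
  - move=> n; apply: emeasurable_funM => //.
    exact/measurable_EFinP/measurable_funP.
  - by move=> n y _; rewrite mule_ge0// lee_fin.
  - move=> y _ a b ab; rewrite lee_wpmul2r ?lee_fin//.
    exact/lefP/nd_nnsfun_approx.
congr (limn _); apply/funext => n.
under eq_integral do rewrite fimfunE -fsumEFin//.
rewrite ge0_integral_fsum//; last 2 first.
- by move=> y; exact/measurable_EFinP/measurable_funM.
- by move=> y x _; rewrite nnfun_muleindic_ge0.
transitivity (\int[m]_x (\sum_(r \in range (f_ n))
    (r * \1_(f_ n @^-1` [set r]) x)%:E * (p x)%:E)); last first.
  apply: eq_integral => x _; rewrite [in RHS]fimfunE -fsumEFin//.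
  rewrite ge0_mule_fsuml// => r.
  by rewrite lee_fin; have := nnfun_muleindic_ge0 (f_ n) r x; rewrite lee_fin.
rewrite ge0_integral_fsum//; last 2 first.
- move=> y; have h : measurable_fun setT (fun x => (y * \1_(f_ n @^-1` [set y]) x)%:E).
    exact/measurable_EFinP/measurable_funM.
  exact: emeasurable_funM h mpE.
- by move=> y x _; rewrite mule_ge0// ?lee_fin//; have := nnfun_muleindic_ge0 (f_ n) y x; rewrite lee_fin.
apply: eq_fsbigr => r /set_mem[t _ rE].
have r0 : (0 <= r)%R by rewrite -rE.
rewrite integralZl_indic_nnsfun// integral_indic//= setIT nuE//.
under [RHS]eq_integral do rewrite EFinM -muleA.
rewrite ge0_integralZl//; last 2 first.
- have h : measurable_fun setT (EFin \o (\1_(f_ n @^-1` [set r]) : T -> R)).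
    exact/measurable_EFinP.
  exact: emeasurable_funM h mpE.
- by move=> x _; rewrite mule_ge0// lee_fin.
congr (_ * _).
rewrite integral_mkcond; apply: eq_integral => x _.
by rewrite /patch indicE; case: ifP => _; rewrite ?mul1e ?mul0e.
Qed.

Lemma integral_normal_probE m s (f : R -> \bar R) :
  measurable_fun setT f -> (forall x, 0 <= f x) ->
  \int[normal_prob m s]_x f x = \int[mu]_x (f x * (normal_pdf m s x)%:E).
Proof.
move=> mf f0; apply: ge0_integral_density => //.
- exact: measurable_normal_pdf.
- by move=> x; exact: normal_pdf_ge0.
Qed.

(** By uniqueness of Lebesgue measure: [c] times the image of [mu] under [x |-> a + c * x] gives
    every half-open interval its length. *)
Lemma ge0_integral_affine (a c : R) (f : R -> \bar R) : (0 < c)%R ->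
  measurable_fun setT f -> (forall x, 0 <= f x) ->
  \int[mu]_x f x = c%:E * \int[mu]_x f (a + c * x)%R.
Proof.
move=> c0 mf f0.
have mphi : measurable_fun [set: measurableTypeR R]
    (fun x : measurableTypeR R => (a + c * x)%R : measurableTypeR R).
  by apply: measurable_funD => //; exact: measurable_funM.
have cn : (0 <= c)%R by exact: ltW.
pose phi : {mfun measurableTypeR R >-> measurableTypeR R} :=
  HB.pack (fun x : R => (a + c * x)%R : measurableTypeR R)
    (isMeasurableFun.Build _ _ _ _ _ mphi).
pose nu0 := mscale (NngNum cn) (pushforward mu phi).
set nu := nu0 mphi.
have muE A : measurable A -> mu A = nu A.
  apply: lebesgue_measure_unique => _ [[u v]] _ <-.
  change (mu `]u, v] = c%:E * mu ((fun x : R => a + c * x)%R @^-1` `]u, v])).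
  rewrite (_ : _ @^-1` _ = `](u - a) / c, (v - a) / c]%classic)%R; last first.
    apply/seteqP; split => x /=; rewrite !in_itv/= ltr_pdivrMr// ler_pdivlMr//;
    by rewrite ltrBlDl lerBrDl [(x * c)%R]mulrC.
  rewrite !lebesgue_measure_itv/= !lte_fin ltr_pM2r ?invr_gt0// ltrD2r.
  case: ifPn => _; last by rewrite mule0.
  rewrite -!EFinD -EFinM; congr EFin; field; exact: lt0r_neq0.
rewrite (eq_measure_integral nu); last by move=> A mA _; exact: muE.
by rewrite ge0_integral_mscale//= ge0_integral_pushforward//.
Qed.

Lemma ge0_integral_opp (f : R -> \bar R) :
  measurable_fun setT f -> (forall x, 0 <= f x) ->
  \int[mu]_x f x = \int[mu]_x f (- x)%R.
Proof.
move=> mf f0.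
have mN : measurable_fun [set: measurableTypeR R]
    (-%R : measurableTypeR R -> measurableTypeR R) by [].
rewrite -[RHS](ge0_integral_pushforward mN mu (D := setT))//.
by apply: eq_measure_integral => A mA _; exact/esym/lebesgue_measureN.
Qed.

Lemma normal_pdf_gt0 (m s x : R) : (0 < s)%R -> (0 < normal_pdf m s x)%R.
Proof.
move=> s0; rewrite normal_pdfE ?gt_eqF// mulr_gt0 ?expR_gt0//.
by rewrite normal_peak_gt0// gt_eqF.
Qed.

Lemma normal_peakE (s : R) : (0 < s)%R ->
  normal_peak s = (s * Num.sqrt (pi *+ 2))^-1%R.
Proof.
move=> s0; rewrite /normal_peak -mulrnAr sqrtrM ?sqr_ge0//.
by rewrite sqrtr_sqr gtr0_norm.
Qed.

Lemma normal_pdf_affine (m c s x : R) : (0 < c)%R -> (0 < s)%R ->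
  normal_pdf m (c * s) (m + c * x) = (c^-1 * normal_pdf 0 s x)%R.
Proof.
move=> c0 s0; have cs0 : (0 < c * s)%R by rewrite mulr_gt0.
rewrite !normal_pdfE ?gt_eqF// !normal_peakE// /normal_fun.
have -> : (- (m + c * x - m) ^+ 2 / ((c * s) ^+ 2 *+ 2) =
           - (x - 0) ^+ 2 / (s ^+ 2 *+ 2))%R.
  by field; rewrite !gt_eqF.
by rewrite -[(c * s * _)%R]mulrA [in LHS]invfM mulrA.
Qed.

Lemma integral_normal_affine (m c s : R) (f : R -> \bar R) :
  (0 < c)%R -> (0 < s)%R -> measurable_fun setT f -> (forall x, 0 <= f x) ->
  \int[normal_prob 0 s]_x f (m + c * x)%R =
  \int[mu]_x (f x * (normal_pdf m (c * s) x)%:E).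
Proof.
move=> c0 s0 mf f0.
have maff : measurable_fun setT (fun x : R => m + c * x)%R.
  by apply: measurable_funD => //; exact: measurable_funM.
rewrite integral_normal_probE//; last first.
  exact: (measurableT_comp mf maff).
have mpdf : measurable_fun setT (EFin \o normal_pdf m (c * s)).
  by apply/measurable_EFinP; exact: measurable_normal_pdf.
have g0 x : 0 <= f x * (normal_pdf m (c * s) x)%:E.
  by rewrite mule_ge0// lee_fin normal_pdf_ge0.
have mg : measurable_fun setT (fun x => f x * (normal_pdf m (c * s) x)%:E).
  exact: emeasurable_funM mf mpdf.
rewrite [RHS](ge0_integral_affine m c0)//.
rewrite -ge0_integralZl//; last 2 first.
- exact: (measurableT_comp mg maff).
- by rewrite lee_fin ltW.
apply: eq_integral => x _; rewrite normal_pdf_affine// EFinM.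
by rewrite [RHS]muleCA [X in _ = _ * X]muleA -EFinM mulfV ?gt_eqF// mul1r.
Qed.

(** The exponent is proportional to [x ^ 2], so a linear lower bound on the exponential turns a
    comparison of total masses into a bound on the second moment. *)
Lemma normal_pdf_ratio (s t x : R) : (0 < s)%R -> (0 < t)%R ->
  (t / s * normal_pdf 0 t x =
   normal_pdf 0 s x * expR ((s ^- 2 - t ^- 2) / 2 * x ^+ 2))%R.
Proof.
move=> s0 t0; have sq : (0 < Num.sqrt (pi *+ 2) :> R)%R.
  by rewrite sqrtr_gt0 pmulrn_lgt0// pi_gt0.
rewrite !normal_pdfE ?gt_eqF// !normal_peakE// /normal_fun.
rewrite -[RHS]mulrA -expRD.
have -> : (- (x - 0) ^+ 2 / (s ^+ 2 *+ 2) + (s ^- 2 - t ^- 2) / 2 * x ^+ 2 =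
   - (x - 0) ^+ 2 / (t ^+ 2 *+ 2))%R.
  by field; rewrite !gt_eqF.
by field; rewrite !gt_eqF.
Qed.

(* Comparing the densities of variances [s ^ 2] and [t ^ 2] through
   [1 + u <= expR u] squeezes the second moment between the two. *)
Lemma integral_normal_sqr (s : R) : (0 < s)%R ->
  \int[normal_prob 0 s]_x (x ^+ 2)%:E = (s ^+ 2)%:E.
Proof.
move=> s0.
have msq : measurable_fun setT (fun x : R => (x ^+ 2)%:E).
  by apply/measurable_EFinP; exact: measurable_funX.
rewrite integral_normal_probE//; last by move=> x; rewrite lee_fin sqr_ge0.
set M := \int[_]_x _.
have mpdf (t : R) : measurable_fun setT (fun x : R => (normal_pdf 0 t x)%:E).
  by apply/measurable_EFinP; exact: measurable_normal_pdf.
have mg : measurable_fun setT (fun x : R => (x ^+ 2)%:E * (normal_pdf 0 s x)%:E).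
  exact: emeasurable_funM msq (mpdf s).
have g0 (x : R) : 0 <= (x ^+ 2)%:E * (normal_pdf 0 s x)%:E.
  by rewrite -EFinM lee_fin mulr_ge0 ?sqr_ge0 ?normal_pdf_ge0.
have M0 : 0 <= M by exact: integral_ge0.
have p0 (t x : R) : 0 <= (normal_pdf 0 t x)%:E by rewrite lee_fin normal_pdf_ge0.
have kp0 (k t x : R) : (0 <= k)%R -> 0 <= k%:E * (normal_pdf 0 t x)%:E.
  by move=> k0; rewrite mule_ge0.
have kg0 (k x : R) : (0 <= k)%R ->
    0 <= k%:E * ((x ^+ 2)%:E * (normal_pdf 0 s x)%:E).
  by move=> k0; rewrite mule_ge0.
have mkp (k t : R) : measurable_fun setT (fun x : R => k%:E * (normal_pdf 0 t x)%:E).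
  exact: measurable_funeM.
have mkg (k : R) : measurable_fun setT
    (fun x : R => k%:E * ((x ^+ 2)%:E * (normal_pdf 0 s x)%:E)).
  exact: measurable_funeM.
(* Integrate [1 + u <= expR u] against the density of parameter [s]; the right-hand side becomes
   [t / s] times a density of mass one. *)
have up t : (s < t)%R -> 1 + ((s ^- 2 - t ^- 2) / 2)%:E * M <= (t / s)%:E.
  move=> st; have t0 : (0 < t)%R by exact: lt_trans st.
  have d0 : (0 <= (s ^- 2 - t ^- 2) / 2)%R.
    rewrite divr_ge0// subr_ge0 lef_pV2 ?posrE ?exprn_gt0//.
    by rewrite lerXn2r// ?nnegrE; exact: ltW.
  rewrite -(integral_normal_pdf 0 s) -ge0_integralZl// ?lee_fin//.
  rewrite -ge0_integralD//; [|exact: mpdf|by move=> x _; exact: kg0|exact: mkg].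
  have ts0 : (0 <= t / s)%R by rewrite divr_ge0// ltW.
  rewrite -[leRHS]mule1 -(integral_normal_pdf 0 t) -ge0_integralZl//; last exact: mpdf.
  apply: ge0_le_integral => //.
  - by move=> x _; rewrite adde_ge0// kg0.
  - exact: emeasurable_funD (mpdf s) (mkg _).
  - exact: mkp.
  move=> x _; rewrite -!EFinM -EFinD lee_fin normal_pdf_ratio//.
  have := expR_ge1Dx ((s ^- 2 - t ^- 2) / 2 * x ^+ 2)%R.
  move=> /(ler_wpM2l (normal_pdf_ge0 0 s x)); apply: le_trans.
  by rewrite mulrDr mulr1 lerD2l mulrA mulrC.
have lo t : (0 < t)%R -> (t < s)%R ->
    1 <= (t / s)%:E + ((t ^- 2 - s ^- 2) / 2)%:E * M.
  move=> t0 ts.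
  have d0 : (0 <= (t ^- 2 - s ^- 2) / 2)%R.
    rewrite divr_ge0// subr_ge0 lef_pV2 ?posrE ?exprn_gt0//.
    by rewrite lerXn2r// ?nnegrE; exact: ltW.
  have ts0 : (0 <= t / s)%R by rewrite divr_ge0// ltW.
  rewrite -(integral_normal_pdf 0 s) -ge0_integralZl// ?lee_fin//.
  rewrite -[X in X + _]mule1 -(integral_normal_pdf 0 t) -[X in X + _]ge0_integralZl//; last exact: mpdf.
  rewrite -ge0_integralD//; [|by move=> x _; exact: kp0|exact: mkp|by move=> x _; exact: kg0|exact: mkg].
  apply: ge0_le_integral => //.
  - exact: mpdf.
  - exact: emeasurable_funD (mkp _ _) (mkg _).
  move=> x _; rewrite -!EFinM -EFinD lee_fin normal_pdf_ratio//.
  have := expR_ge1Dx ((s ^- 2 - t ^- 2) / 2 * x ^+ 2)%R.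
  move=> /(ler_wpM2l (normal_pdf_ge0 0 s x)); rewrite mulrDr mulr1.
  rewrite -lerBrDr => /le_trans; apply.
  rewrite lerD2l -[(t ^- 2 - _)%R]opprB !mulNr lerN2.
  by rewrite mulrA [leRHS]mulrC.
(* The choice [t = 2 s] in [up] has a positive coefficient in front of [M], which excludes an
   infinite value. *)
have Mfin : M \is a fin_num.
  rewrite ge0_fin_numE//.
  have h : (0 < (s ^- 2 - (s + s) ^- 2) / 2)%R.
    rewrite divr_gt0// subr_gt0 ltf_pV2 ?posrE ?exprn_gt0 ?addr_gt0//.
    by rewrite ltrXn2r// ?nnegrE ?addr_ge0 ?(ltW s0)// ltrDl.
  have := up (s + s)%R; rewrite ltrDl => /(_ s0).
  clear up lo; clearbody M; case: M M0 => [r| |]//= _; first by rewrite ltry.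
  by rewrite gt0_muley ?lte_fin// addey//.
move: M0 up lo; rewrite -(fineK Mfin); set r := fine M.
rewrite lee_fin => r0 up lo; congr EFin; apply/eqP; rewrite eq_le.
have s2 : (0 < s ^+ 2)%R by rewrite exprn_gt0.
apply/andP; split; rewrite leNgt; apply/negP => h.
(* The value [t ^ 2] lies halfway between [s ^ 2] and the supposed moment [r]. Dividing [up] by
   [t - s] gives [(t + s) r <= 2 t ^ 2 s], whereas [s < t] and [t ^ 2 < r] give the reverse strict
   inequality. *)
- pose t := Num.sqrt ((r + s ^+ 2) / 2).
  have t2 : (t ^+ 2 = (r + s ^+ 2) / 2)%R.
    by rewrite sqr_sqrtr// divr_ge0// addr_ge0// ltW.
  have st : (s < t)%R.
    by rewrite -(@ltr_pXn2r _ 2)// ?nnegrE ?sqrtr_ge0 ?(ltW s0)// t2; lra.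
  have t0 : (0 < t)%R by exact: lt_trans st.
  have := up _ st; rewrite -EFinM -EFinD lee_fin => H.
  have : (2 * t ^+ 2 * s ^+ 2 * (1 + (s ^- 2 - t ^- 2) / 2 * r) <=
          2 * t ^+ 2 * s ^+ 2 * (t / s))%R.
    by rewrite ler_pM2l // !mulr_gt0 ?exprn_gt0.
  have -> : (2 * t ^+ 2 * s ^+ 2 * (1 + (s ^- 2 - t ^- 2) / 2 * r) =
     2 * t ^+ 2 * s ^+ 2 + (t - s) * (t + s) * r)%R.
    by field; rewrite !gt_eqF.
  have -> : (2 * t ^+ 2 * s ^+ 2 * (t / s) =
    2 * t ^+ 2 * s ^+ 2 + (t - s) * (2 * t ^+ 2 * s))%R by field; rewrite gt_eqF.
  rewrite lerD2l -mulrA ler_pM2l ?subr_gt0// => H2.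
  have : (t ^+ 2 * (2 * s) < t ^+ 2 * (t + s))%R.
    by rewrite ltr_pM2l ?exprn_gt0//; lra.
  have : (t ^+ 2 * (t + s) < r * (t + s))%R.
    by rewrite ltr_pM2r ?addr_gt0// t2; lra.
  lra.
- pose t := Num.sqrt ((r + s ^+ 2) / 2).
  have t2 : (t ^+ 2 = (r + s ^+ 2) / 2)%R.
    by rewrite sqr_sqrtr// divr_ge0// addr_ge0// ltW.
  have t0 : (0 < t)%R by rewrite sqrtr_gt0; lra.
  have st : (t < s)%R.
    by rewrite -(@ltr_pXn2r _ 2)// ?nnegrE ?sqrtr_ge0 ?(ltW s0)// t2; lra.
  have := lo _ t0 st; rewrite -EFinM -EFinD lee_fin => H.
  have : (2 * t ^+ 2 * s ^+ 2 * 1 <=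
    2 * t ^+ 2 * s ^+ 2 * (t / s + (t ^- 2 - s ^- 2) / 2 * r))%R.
    by rewrite ler_pM2l // !mulr_gt0 ?exprn_gt0.
  have -> : (2 * t ^+ 2 * s ^+ 2 * (t / s + (t ^- 2 - s ^- 2) / 2 * r) =
     2 * t ^+ 2 * s ^+ 2 * 1 + (s - t) * ((t + s) * r - 2 * t ^+ 2 * s))%R.
    by field; rewrite !gt_eqF.
  rewrite lerDl pmulr_rge0 ?subr_gt0// subr_ge0 => H2.
  have : (t ^+ 2 * (t + s) < t ^+ 2 * (2 * s))%R.
    by rewrite ltr_pM2l ?exprn_gt0//; lra.
  have : (r * (t + s) < t ^+ 2 * (t + s))%R.
    by rewrite ltr_pM2r ?addr_gt0// t2; lra.
  lra.
Qed.

End gaussian_integrals.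

(** * Test channels and likelihood ratios for a single channel use *)

Section coordinate_change.
Local Open Scope ereal_scope.
Context {R : realType}.
Local Notation mu := (@lebesgue_measure R).

Lemma measurable_normal_pdf_comp d (T : measurableType d) (m x : T -> R) s :
  (0 < s)%R -> measurable_fun setT m -> measurable_fun setT x ->
  measurable_fun setT (fun w => normal_pdf (m w) s (x w)).
Proof.
move=> s0 mm mx.
rewrite (_ : (fun w => _) = fun w => normal_pdf 0 s (x w - m w)%R).
  apply: (measurableT_comp (measurable_normal_pdf 0 s)).
  exact: measurable_funB.
apply/funext => w; rewrite !normal_pdfE ?gt_eqF// /normal_fun.
by rewrite subr0.
Qed.

Lemma measurable_normal_pdfV s : (0 < s)%R ->
  measurable_fun setT (fun e : R => (normal_pdf 0 s e)^-1)%R.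
Proof.
move=> s0; rewrite (_ : (fun e => _) =
    fun e => (normal_peak s)^-1 * expR (e ^+ 2 / (s ^+ 2 *+ 2)))%R.
  apply: measurable_funM => //; apply: measurableT_comp => //.
  by apply: measurable_funM => //; exact: measurable_funX.
apply/funext => e.
by rewrite normal_pdfE ?gt_eqF// invfM /normal_fun subr0 -expRN mulNr opprK.
Qed.

Lemma measurable_normal_pdf_ratio d (T : measurableType d) (m x y : T -> R) s t :
  (0 < s)%R -> (0 < t)%R -> measurable_fun setT m -> measurable_fun setT x ->
  measurable_fun setT y ->
  measurable_fun setT (fun w => normal_pdf (m w) t (x w) / normal_pdf 0 s (y w))%R.
Proof.
move=> s0 t0 mm mx my; apply: measurable_funM.
  exact: measurable_normal_pdf_comp.
exact: (measurableT_comp (measurable_normal_pdfV s0)).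
Qed.

(** The noise [e2] is outermost because the backward test channel draws [z] from [e2] first and then
    [y] from [z] and [e1]. *)
Definition noise_integral (s1 s2 : R) (F : R * R -> \bar R) : \bar R :=
  \int[normal_prob 0 s2]_e2 \int[normal_prob 0 s1]_e1 F (e1, e2).

Lemma integral_normal_change (m c s : R) (f : R -> \bar R) :
  (0 < c)%R -> (0 < s)%R -> measurable_fun setT f -> (forall x, 0 <= f x) ->
  \int[normal_prob 0 s]_x f (m + c * x)%R =
  \int[normal_prob 0 s]_x
    (f x * (normal_pdf m (c * s) x / normal_pdf 0 s x)%:E).
Proof.
move=> c0 s0 mf f0; rewrite integral_normal_affine//.
have cs0 : (0 < c * s)%R by rewrite mulr_gt0.
rewrite integral_normal_probE; last 2 first.
- apply: (emeasurable_funM mf); apply/measurable_EFinP.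
  exact: measurable_normal_pdf_ratio.
- by move=> x; rewrite mule_ge0// lee_fin divr_ge0// normal_pdf_ge0.
apply: eq_integral => x _; rewrite -muleA -EFinM divfK//.
by rewrite gt_eqF// normal_pdf_gt0.
Qed.

(** This is the test channel for [R2]: the legitimate noise gets mean [x] and standard deviation
    [c * s1], and the second noise is untouched. *)
Lemma noise_integral_shift (s1 s2 c x : R) (F : R * R -> \bar R) :
  (0 < c)%R -> (0 < s1)%R -> measurable_fun setT F -> (forall e, 0 <= F e) ->
  noise_integral s1 s2 (fun e => F (x + c * e.1, e.2)%R) =
  noise_integral s1 s2
    (fun e => F e * (normal_pdf x (c * s1) e.1 / normal_pdf 0 s1 e.1)%:E).
Proof.
move=> c0 s10 mF F0; apply: eq_integral => e2 _ /=.
apply: (@integral_normal_change x c s1 (fun e1 => F (e1, e2))) => //.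
exact: measurableT_comp.
Qed.

(* Under the test channel [z = x + k e2] has variance [(k s2) ^ 2] and [y] given
   [z] is Gaussian with mean [a z] and standard deviation [c s1]; the likelihood
   ratio is taken with respect to [y = x + e1], [z = y + e2]. *)
Lemma noise_integral_backward (s1 s2 a c k x : R) (F : R * R -> \bar R) :
  (0 < c)%R -> (0 < k)%R -> (0 < s1)%R -> (0 < s2)%R ->
  measurable_fun setT F -> (forall e, 0 <= F e) ->
  noise_integral s1 s2 (fun e =>
    let z := (x + k * e.2)%R in let y := (a * z + c * e.1)%R in
    F (y - x, z - y)%R) =
  noise_integral s1 s2 (fun e =>
    let y := (x + e.1)%R in let z := (y + e.2)%R in
    F e * ((normal_pdf (a * z) (c * s1) y / normal_pdf 0 s1 e.1) *
           (normal_pdf x (k * s2) z / normal_pdf 0 s2 e.2))%:E).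
Proof.
move=> c0 k0 s10 s20 mF F0; rewrite /noise_integral/=.
have cs0 : (0 < c * s1)%R by rewrite mulr_gt0.
have ks0 : (0 < k * s2)%R by rewrite mulr_gt0.
(* In the coordinates [(y, z)], [K] is the integrand times the joint density of the outputs under
   the test channel. *)
pose K (q : R * R) := F (q.1 - x, q.2 - q.1)%R *
  (normal_pdf (a * q.2) (c * s1) q.1 * normal_pdf x (k * s2) q.2)%:E.
have K0 q : 0 <= K q.
  by rewrite mule_ge0// lee_fin mulr_ge0// normal_pdf_ge0.
have mK : measurable_fun setT K.
  apply: emeasurable_funM.
    apply: (measurableT_comp mF); apply: measurable_fun_pair.
      exact: measurable_funB.
    exact: measurable_funB.
  apply/measurable_EFinP/measurable_funM; apply: measurable_normal_pdf_comp => //.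
  exact: measurable_funM.
pose H (z : R) := \int[mu]_y
  (F (y - x, z - y)%R * (normal_pdf (a * z) (c * s1) y)%:E).
have mH : measurable_fun setT H.
  apply: (@measurable_fun_fubini_tonelli_G _ _ _ _ _ mu (fun q : R * R =>
    F (q.1 - x, q.2 - q.1)%R * (normal_pdf (a * q.2) (c * s1) q.1)%:E)).
    apply: emeasurable_funM.
      apply: (measurableT_comp mF); apply: measurable_fun_pair.
        exact: measurable_funB.
      exact: measurable_funB.
    apply/measurable_EFinP; apply: measurable_normal_pdf_comp => //.
    exact: measurable_funM.
  by move=> q; rewrite mule_ge0// lee_fin normal_pdf_ge0.
have mF1 (z : R) : measurable_fun setT (fun y : R => F (y - x, z - y)%R).
  apply: (measurableT_comp mF); apply: measurable_fun_pair.
    exact: measurable_funB.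
  exact: measurable_funB.
have H0 z : 0 <= H z.
  by apply: integral_ge0 => y _; rewrite mule_ge0// lee_fin normal_pdf_ge0.
transitivity (\int[normal_prob 0 s2]_e2 H (x + k * e2)%R).
  apply: eq_integral => e2 _.
  exact: (@integral_normal_affine _ (a * (x + k * e2)) c s1
    (fun y => F (y - x, x + k * e2 - y)%R)).
rewrite integral_normal_affine//.
transitivity (\int[mu]_z \int[mu]_y K (y, z)).
  apply: eq_integral => z _; rewrite muleC -ge0_integralZl//; last 3 first.
  - apply: emeasurable_funM; first exact: mF1.
    by apply/measurable_EFinP; exact: measurable_normal_pdf.
  - by move=> y _; rewrite mule_ge0// lee_fin normal_pdf_ge0.
  - by rewrite lee_fin normal_pdf_ge0.
  by apply: eq_integral => y _; rewrite muleC -muleA -EFinM.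
(* With [y] outermost, the translations [y = x + e1] and then [z = y + e2] are available; a second
   exchange restores the order of [noise_integral]. *)
transitivity (\int[mu]_y \int[mu]_z K (y, z)).
  by apply/esym; exact: (@fubini_tonelli _ _ _ _ _ mu mu K).
pose L (e : R * R) := K (x + e.1, x + e.1 + e.2)%R.
have mL : measurable_fun setT L.
  apply: (measurableT_comp mK); apply: measurable_fun_pair => /=.
    exact: measurable_funD.
  by apply: measurable_funD => //; exact: measurable_funD.
have L0 e : 0 <= L e by exact: K0.
transitivity (\int[mu]_e1 \int[mu]_e2 L (e1, e2)).
  rewrite (@ge0_integral_affine _ x 1)//; last 2 first.
  - exact: (@measurable_fun_fubini_tonelli_F _ _ _ _ _ mu K).
  - by move=> y; exact: integral_ge0.
  rewrite mul1e; apply: eq_integral => e1 _; rewrite mul1r.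
  rewrite (@ge0_integral_affine _ (x + e1) 1)//; last first.
    exact: measurableT_comp.
  by rewrite mul1e; apply: eq_integral => e2 _; rewrite mul1r.
transitivity (\int[mu]_e2 \int[mu]_e1 L (e1, e2)).
  exact: (@fubini_tonelli _ _ _ _ _ mu mu L).
have mR : measurable_fun setT (fun e : R * R =>
    F e * (normal_pdf (a * (x + e.1 + e.2)) (c * s1) (x + e.1) / normal_pdf 0 s1 e.1 *
      (normal_pdf x (k * s2) (x + e.1 + e.2) / normal_pdf 0 s2 e.2))%:E).
  apply: (emeasurable_funM mF); apply/measurable_EFinP.
  have mz : measurable_fun setT (fun e : R * R => x + e.1 + e.2)%R.
    by apply: measurable_funD => //; exact: measurable_funD.
  apply: measurable_funM; apply: measurable_normal_pdf_ratio => //.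
    exact: measurable_funM.
  exact: measurable_funD.
have R0 (e : R * R) : 0 <=
    F e * (normal_pdf (a * (x + e.1 + e.2)) (c * s1) (x + e.1) / normal_pdf 0 s1 e.1 *
      (normal_pdf x (k * s2) (x + e.1 + e.2) / normal_pdf 0 s2 e.2))%:E.
  by rewrite mule_ge0// lee_fin !mulr_ge0 ?invr_ge0// normal_pdf_ge0.
rewrite [RHS]integral_normal_probE; last 2 first.
- exact: (@measurable_fun_fubini_tonelli_G _ _ _ _ _ (normal_prob 0 s1) _ mR R0).
- by move=> e2; apply: integral_ge0 => e1 _; exact: (R0 (e1, e2)).
apply: eq_integral => e2 _.
rewrite [X in _ = X * _]integral_normal_probE; last 2 first.
- exact: (measurableT_comp mR).
- by move=> e1; exact: (R0 (e1, e2)).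
rewrite muleC -ge0_integralZl//; last 3 first.
- apply: emeasurable_funM; first exact: (measurableT_comp mR).
  by apply/measurable_EFinP; exact: measurable_normal_pdf.
- by move=> e1 _; rewrite mule_ge0 ?(R0 (e1, e2))// lee_fin normal_pdf_ge0.
- by rewrite lee_fin normal_pdf_ge0.
apply: eq_integral => e1 _; rewrite /L /K/=.
have -> : (x + e1 - x = e1)%R by ring.
have -> : (x + e1 + e2 - (x + e1) = e2)%R by ring.
rewrite [RHS]muleC -!muleA -!EFinM; congr (_ * _%:E).
by field; rewrite !gt_eqF ?normal_pdf_gt0.
Qed.

End coordinate_change.

(** * Independence of disjoint blocks of sources *)

Section block_independence.
Local Open Scope ereal_scope.
Context {R : realType} d (Om : measurableType d) (P : probability Om R).
Context (I : finType) (E : I -> set (set Om)).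
Hypothesis mE : forall i, E i `<=` measurable.
Hypothesis EI : forall i, setI_closed (E i).
Hypothesis ET : forall i, E i setT.
Hypothesis indepE : mutually_independent P E.

(** A pi-system generating the information of the sources in [J]. Families are indexed by all of
    [I], with [setT] outside [J], so that mutual independence, a statement on full families, applies
    directly. *)
Definition block (J : pred I) : set (set Om) :=
  [set X | exists A : I -> set Om, [/\ forall i, E i (A i),
    forall i, ~~ J i -> A i = setT & X = \bigcap_(i in [set: I]) A i]].

Lemma block_measurable J : block J `<=` measurable.
Proof.
move=> _ [A [EA _ ->]]; apply: fin_bigcap_measurable => // i _.
exact/mE/EA.
Qed.

Lemma block_setI J : setI_closed (block J).
Proof.
move=> _ _ [A [EA JA ->]] [B [EB JB ->]]; exists (fun i => A i `&` B i); split.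
- by move=> i; exact: EI.
- by move=> i Ji; rewrite JA// JB// setIT.
- by rewrite bigcapI.
Qed.

Lemma block_setT J : block J setT.
Proof.
exists (fun=> setT); split => //.
by apply/seteqP; split => // x _ i _.
Qed.

Lemma block_mem (J : pred I) i A : J i -> E i A -> block J A.
Proof.
move=> Ji EA; exists (fun j => if j == i then A else setT); split.
- by move=> j; case: eqP => [->|_].
- by move=> j; case: eqP => [->|//]; rewrite Ji.
apply/seteqP; split=> [x Ax j _|x /(_ i Logic.I)]; last by rewrite eqxx.
by case: eqP.
Qed.

Lemma sub_block (J K : pred I) : {subset J <= K} -> block J `<=` block K.
Proof.
move=> JK X [A [EA JA XE]]; exists A; split => // i Ki; apply: JA.
by apply: contra Ki; exact: JK.
Qed.

Lemma sigma_block_measurable J : <<s block J >> `<=` measurable.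
Proof.
by apply: smallest_sub; [exact: sigma_algebra_measurable|exact: block_measurable].
Qed.

Lemma measurable_fun_block d' (T : measurableType d') J (X : Om -> T) :
  measurable_fun [set: g_sigma_algebraType (block J)] X ->
  measurable_fun [set: Om] X.
Proof.
by move=> mX _ B mB; apply: (@sigma_block_measurable J); exact: mX.
Qed.

Lemma measurable_fun_sub_block d' (T : measurableType d') (J K : pred I)
    (X : Om -> T) : {subset J <= K} ->
  measurable_fun [set: g_sigma_algebraType (block J)] X ->
  measurable_fun [set: g_sigma_algebraType (block K)] X.
Proof.
move=> JK mX _ B mB; have := mX measurableT B mB.
by apply: sub_smallest2r; [exact: smallest_sigma_algebra|exact: sub_block].
Qed.

Lemma measurable_fun_rv_block d' (T : measurableType d') (J : pred I) i
    (X : Om -> T) : J i -> rv_events X `<=` E i ->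
  measurable_fun [set: g_sigma_algebraType (block J)] X.
Proof.
move=> Ji XE _ B mB; rewrite setTI; apply: sub_sigma_algebra.
by apply: (block_mem Ji); apply: XE; exists B.
Qed.

(** On the pi-systems the product formula is read off the joint family. It passes to the generated
    sigma-algebras one argument at a time: with one event fixed, both sides are finite measures in
    the other event that agree on a pi-system. *)
Lemma block_indep (J K : pred I) A B : (forall i, J i -> ~~ K i) ->
  <<s block J >> A -> <<s block K >> B -> P (A `&` B) = P A * P B.
Proof.
move=> JK sA sB.
have pi_indep X Y : block J X -> block K Y -> P (X `&` Y) = P X * P Y.
  move=> bX bY; have mX := block_measurable bX; have mY := block_measurable bY.
  case: bX => X_ [EX JX XE]; case: bY => Y_ [EY KY YE].
  rewrite -[LHS]fineK ?fin_num_measure//; last exact: measurableI.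
  rewrite -[P X]fineK ?fin_num_measure// -[P Y]fineK ?fin_num_measure// -EFinM.
  congr EFin; rewrite {1}XE {1}YE -bigcapI indepE; last by move=> i; exact: EI.
  rewrite XE YE !indepE// -big_split/=; apply: eq_bigr => i _.
  case: (boolP (J i)) => [/JK Ki|Ji].
    by rewrite (KY i)// setIT probability_setT/= mulr1.
  by rewrite (JX i)// setTI probability_setT/= mul1r.
have pT (m : {finite_measure set Om -> \bar R}) (k : nat) : m setT < +oo.
  by rewrite -ge0_fin_numE// fin_num_measure.
have cT : \bigcup_(k : nat) [set: Om] = setT :> set Om.
  by apply/seteqP; split => // x _; exists O.
have half X Y : <<s block J >> X -> block K Y -> P (X `&` Y) = P X * P Y.
  move=> sX bY; have mY := block_measurable bY.
  pose c := NngNum (fine_ge0 (measure_ge0 P Y)).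
  have cE : c%:num%:E = P Y by rewrite /= fineK// fin_num_measure.
  rewrite -cE muleC.
  pose m1 := mrestr P mY; pose m2 := mscale c P.
  apply: (@g_sigma_algebra_measure_unique _ _ _ (block J) (@block_measurable J)
    (fun=> setT) (fun=> block_setT J) cT m1 m2 (@block_setI J)) => //.
  - move=> X' bX'; change (P (X' `&` Y) = c%:num%:E * P X').
    by rewrite cE pi_indep// muleC.
  - move=> k; change (P (setT `&` Y) < +oo); rewrite setTI.
    by rewrite -ge0_fin_numE// fin_num_measure.
have mA := sigma_block_measurable sA.
pose c := NngNum (fine_ge0 (measure_ge0 P A)).
have cE : c%:num%:E = P A by rewrite /= fineK// fin_num_measure.
rewrite -cE setIC.
pose m1 := mrestr P mA; pose m2 := mscale c P.
apply: (@g_sigma_algebra_measure_unique _ _ _ (block K) (@block_measurable K)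
  (fun=> setT) (fun=> block_setT K) cT m1 m2 (@block_setI K)) => //.
- move=> B' bB'; change (P (B' `&` A) = c%:num%:E * P B').
  by rewrite cE setIC; exact: half.
- move=> k; change (P (setT `&` A) < +oo); rewrite setTI.
  by rewrite -ge0_fin_numE// fin_num_measure.
Qed.

(** By [block_indep] the joint law of [X] and [Y] is the product of their laws. The inner variable
    [w'] plays the role of an independent copy, so that all later arguments can stay on [Om]. *)
Lemma block_tonelli d1 d2 (T1 : measurableType d1) (T2 : measurableType d2)
    (J K : pred I) (X : Om -> T1) (Y : Om -> T2) (F : T1 * T2 -> \bar R) :
  (forall i, J i -> ~~ K i) ->
  measurable_fun [set: g_sigma_algebraType (block J)] X ->
  measurable_fun [set: g_sigma_algebraType (block K)] Y ->
  measurable_fun setT F -> (forall x, 0 <= F x) ->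
  \int[P]_w F (X w, Y w) = \int[P]_w \int[P]_w' F (X w, Y w').
Proof.
move=> JK JX KY mF F0.
have mX := measurable_fun_block JX; have mY := measurable_fun_block KY.
have mXY : measurable_fun setT (fun w => (X w, Y w)) by exact: measurable_fun_pair.
pose X' : {mfun Om >-> T1} := HB.pack X (isMeasurableFun.Build _ _ _ _ _ mX).
pose Y' : {mfun Om >-> T2} := HB.pack Y (isMeasurableFun.Build _ _ _ _ _ mY).
pose XY : {mfun Om >-> (T1 * T2)%type} :=
  HB.pack (fun w => (X w, Y w)) (isMeasurableFun.Build _ _ _ _ _ mXY).
rewrite -(ge0_integral_distribution XY)//.
transitivity (\int[distribution P X' \x distribution P Y']_z F z).
  apply: eq_measure_integral => A mA _; apply/esym.
  apply: (@product_measure_unique _ _ _ _ _ (distribution P X')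
    (distribution P Y') (distribution P XY)) => // C D mC mD.
  rewrite /distribution /pushforward/=.
  rewrite -(block_indep JK (A := X @^-1` C) (B := Y @^-1` D))//.
  - by have := JX measurableT C mC; rewrite setTI.
  - by have := KY measurableT D mD; rewrite setTI.
rewrite fubini_tonelli1//.
rewrite (ge0_integral_distribution X'); last 2 first.
- exact: measurable_fun_fubini_tonelli_F.
- by move=> x; exact: integral_ge0.
apply: eq_integral => w _.
rewrite /= /fubini_F (ge0_integral_distribution Y')//.
exact: measurableT_comp.
Qed.

End block_independence.

(** * Change of measure for the whole noise vector *)

Section noise_vector.
Local Open Scope ereal_scope.
Context {R : realType} d (Om : measurableType d) (P : probability Om R).
Context (N : nat) (E : 'I_4 + ('I_N + 'I_N) -> set (set Om)).
Context (s1 s2 : R) (eta1 eta2 : 'I_N -> Om -> R).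
Hypothesis mE : forall i, E i `<=` measurable.
Hypothesis EI : forall i, setI_closed (E i).
Hypothesis ET : forall i, E i setT.
Hypothesis indepE : mutually_independent P E.
Hypothesis Eeta1 : forall j, rv_events (eta1 j) `<=` E (inr (inl j)).
Hypothesis Eeta2 : forall j, rv_events (eta2 j) `<=` E (inr (inr j)).
Hypothesis law1 : forall j B, measurable B ->
  P (eta1 j @^-1` B) = normal_prob 0 s1 B.
Hypothesis law2 : forall j B, measurable B ->
  P (eta2 j @^-1` B) = normal_prob 0 s2 B.

Local Notation sigma J := (g_sigma_algebraType (block E J)).

Lemma measurable_eta1 (J : pred _) j : J (inr (inl j)) ->
  measurable_fun [set: sigma J] (eta1 j).
Proof. by move=> Jj; exact: (measurable_fun_rv_block ET Jj (@Eeta1 j)). Qed.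

Lemma measurable_eta2 (J : pred _) j : J (inr (inr j)) ->
  measurable_fun [set: sigma J] (eta2 j).
Proof. by move=> Jj; exact: (measurable_fun_rv_block ET Jj (@Eeta2 j)). Qed.

Lemma measurable_fun_mktuple d1 d2 (T1 : measurableType d1)
    (T2 : measurableType d2) n (f : 'I_n -> T1 -> T2) :
  (forall i, measurable_fun setT (f i)) ->
  measurable_fun setT (fun x => [tuple f i x | i < n]).
Proof.
move=> mf; apply/measurable_fun_tnthP => i.
by rewrite (_ : _ \o _ = f i)//; apply/funext => x /=; rewrite tnth_mktuple.
Qed.

Lemma integral_law (X : Om -> R) s (f : R -> \bar R) :
  measurable_fun setT X ->
  (forall B, measurable B -> P (X @^-1` B) = normal_prob 0 s B) ->
  measurable_fun setT f -> (forall x, 0 <= f x) ->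
  \int[P]_w f (X w) = \int[normal_prob 0 s]_x f x.
Proof.
move=> mX XE mf f0.
have mX' : measurable_fun [set: Om] (X : Om -> measurableTypeR R) by exact: mX.
pose X' : {mfun Om >-> measurableTypeR R} :=
  HB.pack (X : Om -> measurableTypeR R) (isMeasurableFun.Build _ _ _ _ _ mX').
rewrite -(ge0_integral_distribution X')//.
by apply: eq_measure_integral => A mA _; exact: XE.
Qed.

Lemma measurable_eta1T j : measurable_fun setT (eta1 j).
Proof.
by apply: (measurable_fun_block mE (J := predT)); exact: measurable_eta1.
Qed.

Lemma measurable_eta2T j : measurable_fun setT (eta2 j).
Proof.
by apply: (measurable_fun_block mE (J := predT)); exact: measurable_eta2.
Qed.

Lemma integral_noise j (F : R * R -> \bar R) :
  measurable_fun setT F -> (forall e, 0 <= F e) ->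
  \int[P]_w F (eta1 j w, eta2 j w) = noise_integral s1 s2 F.
Proof.
move=> mF F0.
rewrite (block_tonelli mE EI ET indepE (J := pred1 (inr (inr j)))
  (K := pred1 (inr (inl j))) (X := eta2 j) (Y := eta1 j)
  (F := fun q => F (q.2, q.1))); first last.
- by move=> q.
- by apply: (measurableT_comp mF); exact: measurable_fun_pair.
- by apply: measurable_eta1; rewrite /= eqxx.
- by apply: measurable_eta2; rewrite /= eqxx.
- by move=> i /eqP ->.
under eq_integral => w _.
  rewrite /= (@integral_law _ s1 (fun x => F (x, eta2 j w)))//; last 3 first.
  - exact: measurable_eta1T.
  - exact: law1.
  - exact: measurableT_comp.
  over.
apply: (@integral_law _ s2 (fun y => \int[normal_prob 0 s1]_x F (x, y))).
- exact: measurable_eta2T.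
- exact: law2.
- exact: (@measurable_fun_fubini_tonelli_G _ _ _ _ _ (normal_prob 0 s1) F).
- by move=> y; exact: integral_ge0.
Qed.

Section change_of_measure.
(** For a parameter [x], [A x] transforms a true noise pair into one distributed as under the test
    channel, and [l x] is the corresponding likelihood ratio. *)
Variables (A : R -> R * R -> R * R) (l : R -> R * R -> R).
Hypothesis mA : measurable_fun setT (fun q : R * (R * R) => A q.1 q.2).
Hypothesis ml : measurable_fun setT (fun q : R * (R * R) => l q.1 q.2).
Hypothesis l0 : forall x e, (0 <= l x e)%R.
Hypothesis Al : forall x (F : R * R -> \bar R), measurable_fun setT F ->
  (forall e, 0 <= F e) ->
  noise_integral s1 s2 (fun e => F (A x e)) =
  noise_integral s1 s2 (fun e => F e * (l x e)%:E).

Let pair_eta j w := (eta1 j w, eta2 j w).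

Let mAx d1 (T1 : measurableType d1) (x : T1 -> R) (e : T1 -> R * R) :
  measurable_fun setT x -> measurable_fun setT e ->
  measurable_fun setT (fun w => A (x w) (e w)).
Proof.
by move=> mx me; exact: (measurableT_comp mA (measurable_fun_pair mx me)).
Qed.

Let mlx d1 (T1 : measurableType d1) (x : T1 -> R) (e : T1 -> R * R) :
  measurable_fun setT x -> measurable_fun setT e ->
  measurable_fun setT (fun w => l (x w) (e w)).
Proof.
by move=> mx me; exact: (measurableT_comp ml (measurable_fun_pair mx me)).
Qed.

Let mktuple_cons n (T : Type) (f : 'I_n.+1 -> T) :
  [tuple f i | i < n.+1] =
  [the n.+1.-tuple T of f ord0 :: [tuple f (lift ord0 i) | i < n]].
Proof.
apply: eq_from_tnth => i; rewrite tnth_mktuple.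
case: (unliftP ord0 i) => [j ->|->]; last by [].
by rewrite tnthS tnth_mktuple.
Qed.

(** Induction on the number of uses. Distinct uses are independent, so the tail is changed with the
    head frozen, by induction, and then the head with the tail frozen, by [Al]. The injection [h]
    lets the statement speak of any subfamily of uses, in particular of the tail. *)
Let tensor n (h : 'I_n -> 'I_N) (p : n.-tuple R) (F : n.-tuple (R * R) -> \bar R) :
  injective h -> measurable_fun setT F -> (forall t, 0 <= F t) ->
  \int[P]_w F [tuple A (tnth p i) (pair_eta (h i) w) | i < n] =
  \int[P]_w (F [tuple pair_eta (h i) w | i < n] *
             (\prod_(i < n) l (tnth p i) (pair_eta (h i) w))%:E).
Proof.
elim: n => [|n IHn] in h p F *.
  move=> _ mF F0; apply: eq_integral => w _.
  by rewrite big_ord0 mule1; congr F; apply: eq_from_tnth => -[].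
move=> inj_h mF F0.
pose J : pred ('I_4 + ('I_N + 'I_N)) :=
  [pred i | (i == inr (inl (h ord0))) || (i == inr (inr (h ord0)))].
pose K : pred ('I_4 + ('I_N + 'I_N)) := predC J.
have JK i : J i -> ~~ K i by rewrite /K /= negbK.
have KJ i : K i -> ~~ J i by [].
pose h' i := h (lift ord0 i).
have inj_h' : injective h' by move=> i j /inj_h /lift_inj.
pose p' := [tuple tnth p (lift ord0 i) | i < n].
pose X := pair_eta (h ord0).
pose Y w := [tuple pair_eta (h' i) w | i < n].
have mX : measurable_fun [set: sigma J] X.
  apply: measurable_fun_pair; first by apply: measurable_eta1; rewrite /J /= eqxx.
  by apply: measurable_eta2; rewrite /J /= eqxx.
have mY : measurable_fun [set: sigma K] Y.
  apply: (@measurable_fun_mktuple _ _ (sigma K) _ _ (fun i => pair_eta (h' i))) => i.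
  have hi : h' i != h ord0 by rewrite (inj_eq inj_h).
  apply: measurable_fun_pair.
    by apply: measurable_eta1; rewrite /K /J /= negb_or; apply/andP.
  by apply: measurable_eta2; rewrite /K /J /=.
pose Ft (t : n.-tuple (R * R)) := [tuple A (tnth p' i) (tnth t i) | i < n].
have mFt : measurable_fun setT Ft.
  apply: (measurable_fun_mktuple (f := fun i t => A (tnth p' i) (tnth t i))) => i.
  by apply: mAx => //; exact: measurable_tnth.
pose lt (t : n.-tuple (R * R)) := (\prod_(i < n) l (tnth p' i) (tnth t i))%R.
have mlt : measurable_fun setT lt.
  apply: measurable_prod => i _.
  by apply: mlx => //; exact: measurable_tnth.
have lt0 t : (0 <= lt t)%R by apply: prodr_ge0.
have ltE w : lt (Y w) = (\prod_(i < n) l (tnth p' i) (pair_eta (h' i) w))%R.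
  by apply: eq_bigr => i _; rewrite [tnth (Y w) i]tnth_mktuple.
pose co (e : R * R) (t : n.-tuple (R * R)) :=
  [the n.+1.-tuple (R * R)%type of e :: t].
have mco d1 (T1 : measurableType d1) (e : T1 -> R * R)
    (t : T1 -> n.-tuple (R * R)) : measurable_fun setT e ->
    measurable_fun setT t -> measurable_fun setT (fun x => F (co (e x) (t x))).
  by move=> me mt; apply: (measurableT_comp mF); exact: measurable_cons.
pose a0 := A (tnth p ord0).
have ma0 : measurable_fun setT a0 by apply: mAx.
transitivity (\int[P]_w F (co (a0 (X w)) (Ft (Y w)))).
  apply: eq_integral => w _; rewrite mktuple_cons; congr (F (co _ _)).
  by apply/eq_from_tnth => i; rewrite !tnth_mktuple.
rewrite (block_tonelli mE EI ET indepE JK mX mY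
  (F := fun q => F (co (a0 q.1) (Ft q.2))))//; last first.
  by apply: mco; exact: measurableT_comp.
transitivity (\int[P]_w \int[P]_w' (F (co (a0 (X w)) (Y w')) * (lt (Y w'))%:E)).
  apply: eq_integral => w _ /=.
  transitivity (\int[P]_w' F (co (a0 (X w))
      [tuple A (tnth p' i) (pair_eta (h' i) w') | i < n])).
    apply: eq_integral => w' _; congr (F (co _ _)).
    by apply/eq_from_tnth => i; rewrite !tnth_mktuple.
  rewrite (IHn h' p' (fun t => F (co (a0 (X w)) t)))//; last exact: mco.
  by apply: eq_integral => w' _; rewrite ltE.
have mG : measurable_fun setT (fun q : (R * R) * n.-tuple (R * R) =>
    F (co (a0 q.1) q.2) * (lt q.2)%:E).
  apply: emeasurable_funM.
    by apply: mco => //; exact: measurableT_comp.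
  by apply/measurable_EFinP; exact: measurableT_comp.
have G0 q : 0 <= F (co (a0 q.1) q.2) * (lt q.2)%:E.
  by rewrite mule_ge0// lee_fin.
rewrite -(block_tonelli mE EI ET indepE JK mX mY mG G0)/=.
rewrite (block_tonelli mE EI ET indepE KJ mY mX
  (F := fun q => F (co (a0 q.2) q.1) * (lt q.1)%:E)); last 2 first.
- apply: emeasurable_funM.
    by apply: mco => //; exact: measurableT_comp.
  by apply/measurable_EFinP; exact: measurableT_comp.
- by move=> q; rewrite mule_ge0// lee_fin.
have ml0 : measurable_fun setT (fun e => (l (tnth p ord0) e)%:E).
  by apply/measurable_EFinP; apply: mlx.
transitivity (\int[P]_w \int[P]_w' (F (co (X w') (Y w)) *
    (l (tnth p ord0) (X w'))%:E * (lt (Y w))%:E)).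
  apply: eq_integral => w _ /=.
  rewrite (@integral_noise (h ord0) (fun e => F (co (a0 e) (Y w)) * (lt (Y w))%:E));
    last 2 first.
  - by apply: emeasurable_funM => //; exact: mco.
  - by move=> e; rewrite mule_ge0// lee_fin.
  rewrite (@Al _ (fun e => F (co e (Y w)) * (lt (Y w))%:E)); last 2 first.
  - by apply: emeasurable_funM => //; exact: mco.
  - by move=> e; rewrite mule_ge0// lee_fin.
  rewrite -(@integral_noise (h ord0)); last 2 first.
  - by apply: emeasurable_funM => //; apply: emeasurable_funM => //; exact: mco.
  - by move=> e; rewrite !mule_ge0// lee_fin.
  by apply: eq_integral => w' _; rewrite -!muleA [X in _ * X]muleC.
rewrite -(block_tonelli mE EI ET indepE KJ mY mX
  (F := fun q => F (co q.2 q.1) * (l (tnth p ord0) q.2)%:E * (lt q.1)%:E)); last 2 first.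
- apply: emeasurable_funM.
    apply: emeasurable_funM; first exact: mco.
    exact: (measurableT_comp ml0).
  by apply/measurable_EFinP; exact: measurableT_comp.
- by move=> q; rewrite !mule_ge0// lee_fin.
apply: eq_integral => w _ /=; rewrite big_ord_recl -muleA -EFinM; congr (_ * _%:E).
  by rewrite mktuple_cons.
congr (_ * _)%R; rewrite ltE; apply: eq_bigr => i _.
by rewrite tnth_mktuple.
Qed.

Definition noise w := [tuple (eta1 i w, eta2 i w) | i < N].

Lemma measurable_noise (J : pred _) : (forall i, J (inr i)) ->
  measurable_fun [set: sigma J] noise.
Proof.
move=> Ji; apply: (@measurable_fun_mktuple _ _ (sigma J) _ _ (fun i w => (eta1 i w, eta2 i w))).
move=> i; apply: measurable_fun_pair.
  exact: measurable_eta1.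
exact: measurable_eta2.
Qed.

(* The encoder side is represented by [Om] itself, with the sigma-algebra of
   the messages and of the private randomness. *)
Definition source : pred ('I_4 + ('I_N + 'I_N)) :=
  fun i => if i is inl _ then true else false.

(** Given the encoder side, [x] is a constant vector and [tensor] applies. As [F] receives the
    sample point itself, it may depend on the messages as well as on the inputs. *)
Lemma change_of_measure (x : Om -> N.-tuple R)
    (F : sigma source * N.-tuple (R * R) -> \bar R) :
  measurable_fun [set: sigma source] x ->
  measurable_fun setT F -> (forall q, 0 <= F q) ->
  \int[P]_w F (w, [tuple A (tnth (x w) i) (eta1 i w, eta2 i w) | i < N]) =
  \int[P]_w (F (w, noise w) *
             (\prod_(i < N) l (tnth (x w) i) (eta1 i w, eta2 i w))%:E).
Proof.
move=> mx mF F0.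
pose K := predC source.
have JK i : source i -> ~~ K i by rewrite /K /= negbK.
have mN : measurable_fun [set: sigma K] noise by apply: measurable_noise; case.
(* The identity into [sigma source] serves as the random variable carrying all that the encoders
   know. *)
have mid : measurable_fun [set: sigma source] (idfun : Om -> sigma source).
  exact: measurable_id.
have tonelli (G : sigma source * N.-tuple (R * R) -> \bar R) :
    measurable_fun setT G -> (forall q, 0 <= G q) ->
    \int[P]_w G (w, noise w) = \int[P]_w \int[P]_w' G (w, noise w').
  exact: (@block_tonelli _ _ _ _ _ _ mE EI ET indepE _ _ (sigma source) _
    source K idfun noise G JK mid mN).
have mxi i : measurable_fun [set: sigma source] (fun w => tnth (x w) i).
  by apply: (measurableT_comp (measurable_tnth i)).
have mA' : measurable_fun setT (fun q : sigma source * N.-tuple (R * R) =>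
    [tuple A (tnth (x q.1) i) (tnth q.2 i) | i < N]).
  apply: (measurable_fun_mktuple (f := fun i (q : sigma source * N.-tuple (R * R)) => A (tnth (x q.1) i) (tnth q.2 i))) => i.
  apply: mAx; first exact: (measurableT_comp (mxi i)).
  exact: (measurableT_comp (measurable_tnth i)).
transitivity (\int[P]_w F (w, [tuple A (tnth (x w) i) (tnth (noise w) i) | i < N])).
  apply: eq_integral => w _; congr (F (_, _)).
  by apply: eq_from_tnth => i; rewrite !tnth_mktuple.
rewrite (tonelli (fun q =>
  F (q.1, [tuple A (tnth (x q.1) i) (tnth q.2 i) | i < N])))//; last first.
  by apply: (measurableT_comp mF); exact: measurable_fun_pair.
transitivity (\int[P]_w (F (w, noise w) *
    (\prod_(i < N) l (tnth (x w) i) (tnth (noise w) i))%:E)); last first.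
  apply: eq_integral => w _; congr (_ * _%:E).
  by apply: eq_bigr => i _; rewrite tnth_mktuple.
rewrite (tonelli (fun q =>
  F q * (\prod_(i < N) l (tnth (x q.1) i) (tnth q.2 i))%:E)); last 2 first.
- apply: emeasurable_funM => //; apply/measurable_EFinP.
  apply: measurable_prod => i _; apply: mlx.
    exact: (measurableT_comp (mxi i)).
  exact: (measurableT_comp (measurable_tnth i)).
- by move=> q; rewrite mule_ge0// lee_fin prodr_ge0.
apply: eq_integral => w _ /=.
transitivity (\int[P]_w' F (w, [tuple A (tnth (x w) i) (pair_eta (id i) w') | i < N])).
  apply: eq_integral => w' _; congr (F (_, _)).
  by apply: eq_from_tnth => i; rewrite !tnth_mktuple.
rewrite (@tensor _ id (x w) (fun t => F (w, t)))//; last first.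
  exact: (measurableT_comp mF (pair1_measurable (w : sigma source))).
apply: eq_integral => w' _; congr (_ * _%:E).
by apply: eq_bigr => i _; rewrite tnth_mktuple.
Qed.

End change_of_measure.
End noise_vector.

(** * Expectations of real variables and the logarithmic inequality *)

Section has_integral.
Context {R : realType} d (Om : measurableType d) (P : probability Om R).

(** Integrability and a real value are bundled, so that the expectation of a quadratic form is
    assembled term by term from closure lemmas. *)
Definition has_integral (f : Om -> R) (r : R) : Prop :=
  P.-integrable setT (EFin \o f) /\ (\int[P]_w (f w)%:E = r%:E)%E.

Lemma has_integral_cst r : has_integral (fun=> r) r.
Proof.
split; first exact: finite_measure_integrable_cst.
by rewrite integral_cst//= probability_setT mule1.
Qed.

Lemma has_integralD f g r s :
  has_integral f r -> has_integral g s ->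
  has_integral (fun w => f w + g w) (r + s).
Proof.
move=> [fi fE] [gi gE]; split.
  exact: (integrableD measurableT fi gi).
by under eq_integral do rewrite EFinD; rewrite integralD//= fE gE.
Qed.

Lemma has_integralZ k f r :
  has_integral f r -> has_integral (fun w => k * f w) (k * r).
Proof.
move=> [fi fE]; split.
  exact: (integrableZl measurableT k fi).
by under eq_integral do rewrite EFinM; rewrite integralZl//= fE.
Qed.

Lemma has_integral_sum (I : Type) (r : seq I) (f : I -> Om -> R) (v : I -> R) :
  (forall i, has_integral (f i) (v i)) ->
  has_integral (fun w => \sum_(i <- r) f i w) (\sum_(i <- r) v i).
Proof.
move=> fv; elim: r => [|i r IHr].
  rewrite big_nil (_ : (fun w => _) = fun=> 0); first exact: has_integral_cst.
  by apply/funext => w; rewrite big_nil.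
rewrite big_cons (_ : (fun w => _) = fun w => f i w + \sum_(j <- r) f j w).
  exact: has_integralD.
by apply/funext => w; rewrite big_cons.
Qed.

Lemma has_integral_ext (f g : Om -> R) r s : has_integral f r -> (forall w, g w = f w) ->
  s = r -> has_integral g s.
Proof. by move=> h /funext -> ->. Qed.

Lemma has_integral_le (f g : Om -> R) r s : has_integral f r -> has_integral g s ->
  (forall w, f w <= g w) -> r <= s.
Proof.
move=> [fi fE] [gi gE] fg; rewrite -lee_fin -fE -gE.
by apply: le_integral => // w _; rewrite lee_fin.
Qed.

Lemma ge0_has_integral (f : Om -> R) r : measurable_fun setT f -> (forall w, 0 <= f w) ->
  (\int[P]_w (f w)%:E = r%:E)%E -> has_integral f r.
Proof.
move=> mf f0 fr; split=> //; apply/integrableP; split.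
  exact/measurable_EFinP.
under eq_integral do rewrite /= ger0_norm//.
by rewrite fr ltry.
Qed.

(** The product is dominated by [f ^ 2 + g ^ 2]. This provides the cross moments of the two
    inputs. *)
Lemma has_integral_mul (f g : Om -> R) r s :
  measurable_fun setT f -> measurable_fun setT g ->
  has_integral (fun w => f w ^+ 2) r -> has_integral (fun w => g w ^+ 2) s ->
  exists t, has_integral (fun w => f w * g w) t.
Proof.
move=> mf mg f2 g2.
have [si _] := has_integralD f2 g2.
have fgi : P.-integrable setT (EFin \o (fun w => f w * g w)).
  apply: le_integrable si => //.
    by apply/measurable_EFinP; exact: measurable_funM.
  move=> w _ /=; rewrite lee_fin normrM [leRHS]ger0_norm ?addr_ge0 ?sqr_ge0//.
  rewrite -[f w ^+ 2]real_normK ?num_real// -[g w ^+ 2]real_normK ?num_real//.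
  have := sqr_ge0 (`|f w| - `|g w|); have := sqr_ge0 (`|f w| + `|g w|).
  nra.
exists (fine (\int[P]_w (f w * g w)%:E)%E); split=> //.
by rewrite fineK//; exact: integrable_fin_num.
Qed.

(* Jensen's inequality for [ln (T * expR (- L))], in the form
   [ln u <= u - 1]. *)
Lemma integral_ln_le (L T : Om -> R) (v K : R) :
  has_integral L v -> measurable_fun setT T -> (forall w, 1 <= T w) ->
  (\int[P]_w (T w * expR (- L w))%:E <= K%:E)%E ->
  (\int[P]_w (ln (T w))%:E <= (v + (K - 1))%:E)%E.
Proof.
move=> hL mT T1 TK; have [iL _] := hL.
have mL : measurable_fun setT L by apply/measurable_EFinP; exact: measurable_int iL.
have T0 w : 0 < T w by exact: lt_le_trans (T1 w).
have TL0 w : 0 <= T w * expR (- L w) by rewrite mulr_ge0 ?expR_ge0// ltW.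
have mTL : measurable_fun setT (fun w => T w * expR (- L w)).
  apply: measurable_funM => //; apply: measurableT_comp => //.
  exact: measurableT_comp.
have int0 : (0 <= \int[P]_w (T w * expR (- L w))%:E)%E.
  by apply: integral_ge0 => w _; rewrite lee_fin.
have intE : (\int[P]_w (T w * expR (- L w))%:E =
    (fine (\int[P]_w (T w * expR (- L w))%:E))%:E)%E.
  rewrite fineK// ge0_fin_numE//; exact: le_lt_trans TK (ltry _).
have hTL := ge0_has_integral mTL TL0 intE.
have hR := has_integralD hL (has_integralD hTL (has_integral_cst (-1))).
have lnle w : ln (T w) <= L w + (T w * expR (- L w) + -1).
  rewrite -lerBlDl; have := expR_ge1Dx (ln (T w) - L w).
  by rewrite expRD lnK ?posrE//; lra.
have ln0 w : 0 <= ln (T w) by exact: ln_ge0.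
have mlnT : measurable_fun setT (fun w => ln (T w)) by exact: measurableT_comp.
apply: (@le_trans _ _ (\int[P]_w (L w + (T w * expR (- L w) + -1))%:E)%E).
  apply: ge0_le_integral => //.
  - by move=> w _; rewrite lee_fin.
  - exact/measurable_EFinP.
  - exact: (measurable_int P hR.1).
  - by move=> w _; rewrite lee_fin.
by rewrite hR.2 lee_fin lerD2l lerD2r -lee_fin -intE.
Qed.

End has_integral.

(** * The cross-entropy bound on conditional entropy *)

Section entropy.
Context {R : realType} d (Om : measurableType d) (P : probability Om R).

Lemma measure_fin_partition (F : finType) (V : Om -> F) (B : set Om) :
  (forall a, measurable (V @^-1` [set a])) -> measurable B ->
  fine (P B) = \sum_a fine (P [set w | V w = a /\ B w]).
Proof.
move=> mV mB.
have mVB a : measurable [set w | V w = a /\ B w] by apply: measurableI (mV a) mB.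
apply: EFin_inj; rewrite fineK ?fin_num_measure// -sumEFin.
rewrite -[in LHS](setIT B) -integral_indic//.
transitivity (\int[P]_w (\sum_a (\1_[set w | V w = a /\ B w] w)%:E))%E.
  apply: eq_integral => w _; rewrite sumEFin; congr EFin.
  rewrite (bigD1 (V w))//= big1 ?addr0 => [|a aV].
    by rewrite !indicE; congr (nat_of_bool _)%:R; apply: asbool_equiv_eq => /=; tauto.
  by rewrite indicE memNset// => -[Va _]; move: aV; rewrite Va eqxx.
rewrite ge0_integral_sum//; last by move=> a; apply/measurable_EFinP.
apply: eq_bigr => a _.
by rewrite integral_indic// setIT fineK// fin_num_measure.
Qed.

Lemma ge0_integral_fin (F : finType) (V : Om -> F) (h : F -> R) :
  (forall a, measurable (V @^-1` [set a])) -> (forall a, 0 <= h a) ->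
  (\int[P]_w (h (V w))%:E = (\sum_a h a * fine (P (V @^-1` [set a])))%:E)%E.
Proof.
move=> mV h0.
have mi a : measurable_fun setT (fun w => (h a * \1_(V @^-1` [set a]) w)%:E).
  by apply/measurable_EFinP; apply: measurable_funM.
transitivity (\int[P]_w (\sum_a (h a * \1_(V @^-1` [set a]) w)%:E))%E.
  apply: eq_integral => w _; rewrite sumEFin; congr EFin.
  rewrite (bigD1 (V w))//= indicE mem_set// mulr1 big1 ?addr0// => a aV.
  rewrite indicE memNset ?mulr0// => /= Va.
  by move: aV; rewrite Va eqxx.
rewrite ge0_integral_sum//; last first.
  by move=> a w _; rewrite lee_fin mulr_ge0.
rewrite -sumEFin; apply: eq_bigr => a _.
under eq_integral do rewrite EFinM.
rewrite ge0_integralZl ?lee_fin//; last exact/measurable_EFinP.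
by rewrite integral_indic// setIT EFinM fineK// fin_num_measure.
Qed.

(** Gibbs' inequality: coding with a mismatched conditional law [q] costs at least the entropy. The
    factor [ln 2] converts bits to nats. *)
Lemma disc_cond_entropy_le (F G : finType) (A : Om -> F) (V : Om -> G)
    (q : F -> G -> R) :
  (forall a, measurable (A @^-1` [set a])) ->
  (forall v, measurable (V @^-1` [set v])) ->
  (forall a v, 0 < q a v) -> (forall v, \sum_a q a v <= 1) ->
  ((ln 2 * disc_cond_entropy P A V)%:E <= \int[P]_w (- ln (q (A w) (V w)))%:E)%E.
Proof.
move=> mA mV q0 q1.
have ln20 : ln 2 != 0 :> R by rewrite gt_eqF// ln_gt0// ltr1n.
have q_le1 a v : q a v <= 1.
  apply: le_trans (q1 v); rewrite (bigD1 a)//= lerDl.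
  by apply: sumr_ge0 => b _; exact: ltW.
pose AV w := (A w, V w).
have AVE a v : AV @^-1` [set (a, v)] = [set w | A w = a /\ V w = v].
  by apply/seteqP; split=> w /=; rewrite /AV; [case=> -> ->|case=> -> ->].
have mAV x : measurable (AV @^-1` [set x]).
  by case: x => a v; rewrite AVE; exact: measurableI (mA a) (mV v).
rewrite (@ge0_integral_fin _ AV (fun x => - ln (q x.1 x.2)) mAV); last first.
  by move=> x; rewrite oppr_ge0 -[leRHS]ln1 ler_ln ?posrE.
pose pj a v := fine (P [set w | A w = a /\ V w = v]).
pose pv v := fine (P [set w | V w = v]).
have pj0 a v : 0 <= pj a v by rewrite fine_ge0.
have pvE v : pv v = \sum_a pj a v by exact: measure_fin_partition mA (mV v).
have pj_pv a v : pj a v <= pv v.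
  by rewrite pvE (bigD1 a)//= lerDl sumr_ge0.
have pv0 v : 0 <= pv v by rewrite fine_ge0.
rewrite lee_fin (eq_bigr (fun x => - ln (q x.1 x.2) * pj x.1 x.2)); last first.
  by case=> a v _; rewrite AVE.
rewrite -(pair_bigA _ (fun a v => - ln (q a v) * pj a v))/=.
(* These are the corrections left by [ln u <= u - 1] at [u = q * pv / pj]; for each [v] they sum to
   at most zero because [q] has mass at most one. *)
have qp : \sum_a \sum_v (q a v * pv v - pj a v) <= 0.
  rewrite exchange_big/= sumr_le0// => v _.
  by rewrite sumrB -mulr_suml -pvE subr_le0 ler_piMl.
rewrite /disc_cond_entropy mulrN mulr_sumr -sumrN.
apply: le_trans (_ : _ <= \sum_a \sum_v - ln (q a v) * pj a v +
  \sum_a \sum_v (q a v * pv v - pj a v)) _; last by rewrite gerDl.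
rewrite -big_split/=; apply: ler_sum => a _.
rewrite mulr_sumr -sumrN -big_split/=; apply: ler_sum => v _.
(* If [pj] vanishes, the entropy term is zero by convention and only [q * pv >= 0] remains. *)
rewrite -/(pj a v) -/(pv v); case: eqP => [->|/eqP pjn0].
  by rewrite !mulr0 oppr0 add0r addr0 mulr_ge0// ltW.
have pjgt0 : 0 < pj a v by rewrite lt0r pjn0 pj0.
have pvgt0 : 0 < pv v by exact: lt_le_trans (pj_pv a v).
have -> : ln 2 * (pj a v * log2 (pj a v / pv v)) = pj a v * ln (pj a v / pv v).
  by rewrite /log2; field.
have u0 : 0 < q a v * pv v / pj a v by rewrite divr_gt0// mulr_gt0.
have := expR_ge1Dx (ln (q a v * pv v / pj a v)); rewrite lnK ?posrE//.
rewrite ln_div ?posrE ?mulr_gt0// lnM ?posrE// ln_div ?posrE//.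
move=> /(ler_wpM2l (pj0 a v)).
have -> : pj a v * (q a v * pv v / pj a v) = q a v * pv v by field.
lra.
Qed.

End entropy.

(** * Shifted second moments and explicit likelihood ratios *)

Section gaussian_moments.
Context {R : realType}.

Lemma integral_normal_opp s (f : R -> \bar R) : 0 < s ->
  measurable_fun setT f -> (forall x, 0 <= f x)%E ->
  (\int[normal_prob 0 s]_x f (- x)%R = \int[normal_prob 0 s]_x f x)%E.
Proof.
move=> s0 mf f0.
have mN : measurable_fun [set: R] (-%R : R -> R) by [].
have mp : measurable_fun setT (fun x : R => (normal_pdf 0 s x)%:E).
  by apply/measurable_EFinP; exact: measurable_normal_pdf.
rewrite !integral_normal_probE//; last exact: (measurableT_comp mf).
rewrite [RHS]ge0_integral_opp//; last 2 first.
- exact: (emeasurable_funM mf mp).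
- by move=> x; rewrite mule_ge0// lee_fin normal_pdf_ge0.
apply: eq_integral => x _; congr (_ * _%:E)%E.
by rewrite !normal_pdfE ?gt_eqF// /normal_fun !subr0 sqrrN.
Qed.

(** Adding the integral to its image under [e |-> - e] cancels the cross term, so that every
    integrand stays nonnegative and only the second moment of the noise enters. *)
Lemma integral_normal_sqrD (x k s : R) : 0 < s ->
  (\int[normal_prob 0 s]_e ((x + k * e) ^+ 2)%:E =
   (x ^+ 2 + k ^+ 2 * s ^+ 2)%:E)%E.
Proof.
move=> s0.
have mS (k' : R) : measurable_fun setT (fun e : R => ((x + k' * e) ^+ 2)%:E).
  by apply/measurable_EFinP; apply: measurable_funX; apply: measurable_funD.
have S0 (k' e : R) : (0 <= ((x + k' * e) ^+ 2)%:E)%E by rewrite lee_fin sqr_ge0.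
have opp : (\int[normal_prob 0 s]_e ((x + (- k) * e) ^+ 2)%:E =
    \int[normal_prob 0 s]_e ((x + k * e) ^+ 2)%:E)%E.
  rewrite -[RHS](integral_normal_opp s0 (mS k))//.
  by apply: eq_integral => e _; rewrite mulNr mulrN.
pose I := (\int[normal_prob 0 s]_e ((x + k * e) ^+ 2)%:E)%E; change (I = (x ^+ 2 + k ^+ 2 * s ^+ 2)%:E).
have : (I + I = (2 * (x ^+ 2 + k ^+ 2 * s ^+ 2))%:E)%E.
  rewrite {2}/I -opp {1}/I -ge0_integralD//; try exact: mS.
  transitivity (\int[normal_prob 0 s]_e
      ((2 * x ^+ 2)%:E + (2 * k ^+ 2)%:E * (e ^+ 2)%:E))%E.
    apply: eq_integral => e _; rewrite -EFinM -!EFinD; congr EFin; ring.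
  have msq : measurable_fun setT (fun e : R => (e ^+ 2)%:E).
    by apply/measurable_EFinP; exact: measurable_funX.
  have k20 : (0 <= (2 * k ^+ 2)%:E)%E by rewrite lee_fin mulr_ge0// sqr_ge0.
  rewrite ge0_integralD//; last 3 first.
  - by move=> e _; rewrite lee_fin mulr_ge0 ?sqr_ge0.
  - by move=> e _; rewrite mule_ge0// lee_fin sqr_ge0.
  - exact: measurable_funeM.
  rewrite integral_cst//= probability_setT mule1 ge0_integralZl//; last first.
    by move=> e _; rewrite lee_fin sqr_ge0.
  rewrite integral_normal_sqr// -EFinM -EFinD; congr EFin; ring.
have I0 : (0 <= I)%E by apply: integral_ge0.
move: I I0 => [r| |]//= _ [h]; congr EFin; lra.
Qed.

(** The exponent is one summand of the quadratic form [L], so the product of the ratios over the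
    block is [expR (- L)]. *)
Lemma normal_pdf_ratioE (m s t x y : R) : 0 < s -> 0 < t ->
  normal_pdf m s x / normal_pdf 0 t y =
  expR (- (ln (s / t) + (2 * s ^+ 2)^-1 * (x - m) ^+ 2
                      - (2 * t ^+ 2)^-1 * y ^+ 2)).
Proof.
move=> s0 t0; have sq : 0 < Num.sqrt (pi *+ 2) :> R.
  by rewrite sqrtr_gt0 pmulrn_lgt0// pi_gt0.
rewrite !normal_pdfE ?gt_eqF// !normal_peakE// /normal_fun subr0.
set a := _ * (x - m) ^+ 2; set b := _ * y ^+ 2.
have -> : - (x - m) ^+ 2 / (s ^+ 2 *+ 2) = - a.
  by rewrite /a mulNr mulrC mulr_natl.
have -> : - y ^+ 2 / (t ^+ 2 *+ 2) = - b.
  by rewrite /b mulNr mulrC mulr_natl.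
rewrite (_ : - (ln (s / t) + a - b) = - ln (s / t) + - a + b); last by ring.
rewrite !expRD !expRN lnK ?posrE ?divr_gt0//.
by field; rewrite !gt_eqF ?expR_gt0.
Qed.

End gaussian_moments.

(** * Measurability through finite-valued variables *)

Section finite_valued.
Context d1 d2 d3 (S : measurableType d1) (T1 : measurableType d2)
  (T2 : measurableType d3) (F : finType).

Lemma measurable_fun_fin (W : S -> F) (g : F -> T1 -> T2) (U : S -> T1) :
  (forall k, measurable (W @^-1` [set k])) -> measurable_fun setT U ->
  (forall k, measurable_fun setT (g k)) ->
  measurable_fun setT (fun w => g (W w) (U w)).
Proof.
move=> mW mU mg _ B mB; rewrite setTI.
rewrite (_ : _ @^-1` B =
    \bigcup_(k in [set: F]) (W @^-1` [set k] `&` (g k \o U) @^-1` B)).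
  apply: fin_bigcup_measurable => // k _; apply: measurableI => //.
  by rewrite -[X in measurable X]setTI; exact: (measurableT_comp (mg k) mU).
by apply/seteqP; split=> [w Bw|w [k _ [/= <-]]]; [exists (W w)|].
Qed.

Lemma measurable_eq_fin (V V' : S -> F) :
  (forall k, measurable (V @^-1` [set k])) ->
  (forall k, measurable (V' @^-1` [set k])) ->
  measurable [set w | V w = V' w].
Proof.
move=> mV mV'.
rewrite (_ : [set w | _] =
    \bigcup_(k in [set: F]) (V @^-1` [set k] `&` V' @^-1` [set k])).
  by apply: fin_bigcup_measurable => // k _; exact: measurableI.
by apply/seteqP; split=> [w /= VV'|w [k _ [/= -> ->]]]; [exists (V w)|].
Qed.

End finite_valued.

(** * Second moments after adding independent noise *)

Section moments.
Context {R : realType} d (Om : measurableType d) (P : probability Om R).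
Context (I : finType) (E : I -> set (set Om)).
Hypothesis mE : forall i, E i `<=` measurable.
Hypothesis EI : forall i, setI_closed (E i).
Hypothesis ET : forall i, E i setT.
Hypothesis indepE : mutually_independent P E.

(** Independence allows the noise to be integrated first with [X] frozen. The conclusion has the
    shape of the last hypothesis, so noises can be added one after the other. *)
Lemma has_integral_normal_sqrD (J K : pred I) (X eta : Om -> R) (k s r : R) :
  (forall i, J i -> ~~ K i) -> 0 < s ->
  measurable_fun [set: g_sigma_algebraType (block E J)] X ->
  measurable_fun [set: g_sigma_algebraType (block E K)] eta ->
  (forall B, measurable B -> P (eta @^-1` B) = normal_prob 0 s B) ->
  has_integral P (fun w => X w ^+ 2) r ->
  has_integral P (fun w => (X w + k * eta w) ^+ 2) (r + k ^+ 2 * s ^+ 2).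
Proof.
move=> JK s0 JX Keta law [iX2 X2].
have mX := measurable_fun_block mE JX; have meta := measurable_fun_block mE Keta.
apply: ge0_has_integral.
- apply: measurable_funX; by apply: measurable_funD => //; exact: measurable_funM.
- by move=> w; exact: sqr_ge0.
rewrite (block_tonelli mE EI ET indepE JK JX Keta
  (F := fun q : R * R => ((q.1 + k * q.2) ^+ 2)%:E)); last 2 first.
- apply/measurable_EFinP; apply: measurable_funX; by apply: measurable_funD => //; exact: measurable_funM.
- by move=> q; rewrite lee_fin sqr_ge0.
transitivity (\int[P]_w (X w ^+ 2 + k ^+ 2 * s ^+ 2)%:E)%E.
  apply: eq_integral => w _ /=.
  rewrite (integral_law (f := fun e => ((X w + k * e) ^+ 2)%:E) meta law).
  - exact: integral_normal_sqrD.
  - apply/measurable_EFinP; apply: measurable_funX; exact: measurable_funD.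
  - by move=> e; rewrite lee_fin sqr_ge0.
have [_ <-] := has_integralD (conj iX2 X2) (has_integral_cst P (k ^+ 2 * s ^+ 2)).
by [].
Qed.

End moments.

(** * The two bounds for a fixed code *)

Section code.
Context {R : realType} d (Om : measurableType d) (P : probability Om R).
Context d1 (T1 : measurableType d1) d2 (T2 : measurableType d2).
Context (N M1 M2 : nat).
Context (f1 : 'I_M1 -> T1 -> N.-tuple R) (f2 : 'I_M1 * 'I_M2 -> T2 -> N.-tuple R).
Context (psi : N.-tuple R -> 'I_M1 * 'I_M2).
Context (W1 : Om -> 'I_M1) (W2 : Om -> 'I_M2) (U1 : Om -> T1) (U2 : Om -> T2).
Context (eta1 eta2 : 'I_N -> Om -> R) (s1 s2 : R).

(** This is the family of [gmac_dms_code] up to conversion, so the independence of a code applies as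
    it stands. *)
Definition code_events (i : 'I_4 + ('I_N + 'I_N)) : set (set Om) :=
  match i with
  | inl k => nth set0 [:: fin_events W1; fin_events W2;
                          rv_events U1; rv_events U2] k
  | inr (inl j) => rv_events (eta1 j)
  | inr (inr j) => rv_events (eta2 j)
  end.

Hypothesis s10 : 0 < s1.
Hypothesis s20 : 0 < s2.
Hypothesis M10 : (0 < M1)%N.
Hypothesis M20 : (0 < M2)%N.
Hypothesis mW1 : forall k, measurable (W1 @^-1` [set k]).
Hypothesis mW2 : forall k, measurable (W2 @^-1` [set k]).
Hypothesis lawW2 : forall k, P (W2 @^-1` [set k]) = (M2%:R^-1)%:E.
Hypothesis mU1 : measurable_fun setT U1.
Hypothesis mU2 : measurable_fun setT U2.
Hypothesis mf1 : forall k, measurable_fun setT (f1 k).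
Hypothesis mf2 : forall k, measurable_fun setT (f2 k).
Hypothesis meta1 : forall i, measurable_fun setT (eta1 i).
Hypothesis meta2 : forall i, measurable_fun setT (eta2 i).
Hypothesis law1 : forall i B, measurable B ->
  P (eta1 i @^-1` B) = normal_prob 0 s1 B.
Hypothesis law2 : forall i B, measurable B ->
  P (eta2 i @^-1` B) = normal_prob 0 s2 B.
Hypothesis indep : mutually_independent P code_events.
Hypothesis mpsi : forall m, measurable (psi @^-1` [set m]).

Local Notation E := code_events.
Local Notation sigma J := (g_sigma_algebraType (block E J)).
Local Notation src := (@source N).

Let X1 w := f1 (W1 w) (U1 w).
Let X2 w := f2 (W1 w, W2 w) (U2 w).
Let W w := (W1 w, W2 w).
Let xs w := [tuple tnth (X1 w) i + tnth (X2 w) i | i < N].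
(** The outputs are functions of the summed inputs and of a free vector of noise pairs, to be
    evaluated both at the true noise and at the transformed one. *)
Let rcv (q : N.-tuple R * N.-tuple (R * R)) :=
  [tuple tnth q.1 i + (tnth q.2 i).1 | i < N].
Let eve (q : N.-tuple R * N.-tuple (R * R)) :=
  [tuple tnth q.1 i + (tnth q.2 i).1 + (tnth q.2 i).2 | i < N].
Let Y w := [tuple tnth (X1 w) i + tnth (X2 w) i + eta1 i w | i < N].
Let Z w := [tuple tnth (Y w) i + eta2 i w | i < N].

Lemma fin_events_measurable (F : finType) (V : Om -> F) :
  (forall k, measurable (V @^-1` [set k])) -> fin_events V `<=` measurable.
Proof.
move=> mV _ [B _ <-].
rewrite (_ : V @^-1` B = \bigcup_(k in B) (V @^-1` [set k])).
  by apply: fin_bigcup_measurable => //; exact: finite_finset.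
by apply/seteqP; split=> [w Bw|w [k Bk /= ->]//]; exists (V w).
Qed.

Lemma rv_events_measurable d' (T : measurableType d') (V : Om -> T) :
  measurable_fun setT V -> rv_events V `<=` measurable.
Proof. by move=> mV _ [B mB <-]; rewrite -[X in measurable X]setTI; exact: mV. Qed.

Lemma fin_events_setI (F : finType) (V : Om -> F) : setI_closed (fin_events V).
Proof. by move=> _ _ [A _ <-] [B _ <-]; exists (A `&` B). Qed.

Lemma rv_events_setI d' (T : measurableType d') (V : Om -> T) :
  setI_closed (rv_events V).
Proof.
by move=> _ _ [A mA <-] [B mB <-]; exists (A `&` B) => //; exact: measurableI.
Qed.

Lemma fin_events_setT (F : finType) (V : Om -> F) : fin_events V setT.
Proof. by exists setT. Qed.

Lemma rv_events_setT d' (T : measurableType d') (V : Om -> T) :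
  rv_events V setT.
Proof. by exists setT. Qed.

Lemma code_events_measurable i : E i `<=` measurable.
Proof.
case: i => [k|[j|j]]; last 2 first.
- exact: rv_events_measurable.
- exact: rv_events_measurable.
case: k => -[|[|[|[|]]]]//= _.
- exact: fin_events_measurable.
- exact: fin_events_measurable.
- exact: rv_events_measurable.
- exact: rv_events_measurable.
Qed.

Lemma code_events_setI i : setI_closed (E i).
Proof.
case: i => [k|[j|j]]; last 2 first.
- exact: rv_events_setI.
- exact: rv_events_setI.
case: k => -[|[|[|[|]]]]//= _.
- exact: fin_events_setI.
- exact: fin_events_setI.
- exact: rv_events_setI.
- exact: rv_events_setI.
Qed.

Lemma code_events_setT i : E i setT.
Proof.
case: i => [k|[j|j]]; last 2 first.
- exact: rv_events_setT.
- exact: rv_events_setT.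
case: k => -[|[|[|[|]]]]//= _.
- exact: fin_events_setT.
- exact: fin_events_setT.
- exact: rv_events_setT.
- exact: rv_events_setT.
Qed.

Let mE := code_events_measurable.
Let EI := code_events_setI.
Let ET := code_events_setT.

Let iW1 : 'I_4 + ('I_N + 'I_N) := inl (inord 0).
Let iW2 : 'I_4 + ('I_N + 'I_N) := inl (inord 1).
Let iU1 : 'I_4 + ('I_N + 'I_N) := inl (inord 2).
Let iU2 : 'I_4 + ('I_N + 'I_N) := inl (inord 3).

Let EW1 : E iW1 = fin_events W1. Proof. by rewrite /= inordK. Qed.
Let EW2 : E iW2 = fin_events W2. Proof. by rewrite /= inordK. Qed.
Let EU1 : E iU1 = rv_events U1. Proof. by rewrite /= inordK. Qed.
Let EU2 : E iU2 = rv_events U2. Proof. by rewrite /= inordK. Qed.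

Let iE k l : (k < 4)%N -> (l < 4)%N -> ((inl (inord k) :
  'I_4 + ('I_N + 'I_N)) == inl (inord l)) = (k == l).
Proof.
move=> k4 l4; rewrite (_ : (inl _ == inl _) = (inord k == inord l :> 'I_4))//.
by rewrite -val_eqE /= !inordK.
Qed.

Let block_W1 (J : pred ('I_4 + ('I_N + 'I_N))) k : J iW1 ->
  measurable (W1 @^-1` [set k] : set (sigma J)).
Proof.
move=> JW; apply: sub_sigma_algebra; apply: (block_mem ET JW).
by rewrite EW1; exists [set k].
Qed.

Let block_W2 (J : pred ('I_4 + ('I_N + 'I_N))) k : J iW2 ->
  measurable (W2 @^-1` [set k] : set (sigma J)).
Proof.
move=> JW; apply: sub_sigma_algebra; apply: (block_mem ET JW).
by rewrite EW2; exists [set k].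
Qed.

Let block_W (J : pred ('I_4 + ('I_N + 'I_N))) k : J iW1 -> J iW2 ->
  measurable (W @^-1` [set k] : set (sigma J)).
Proof.
move=> JW1 JW2; case: k => k l.
rewrite (_ : _ @^-1` _ = W1 @^-1` [set k] `&` W2 @^-1` [set l]).
  by apply: measurableI; [exact: block_W1|exact: block_W2].
by apply/seteqP; split=> w /=; rewrite /W; [case=> -> ->|case=> -> ->].
Qed.

Let block_X1 (J : pred ('I_4 + ('I_N + 'I_N))) : J iW1 -> J iU1 ->
  measurable_fun [set: sigma J] X1.
Proof.
move=> JW JU; apply: (@measurable_fun_fin _ _ _ (sigma J) _ _ _ W1 f1 U1) => //.
  by move=> k; exact: block_W1.
by apply: (measurable_fun_rv_block ET JU); rewrite EU1.
Qed.

Let block_X2 (J : pred ('I_4 + ('I_N + 'I_N))) : J iW1 -> J iW2 -> J iU2 ->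
  measurable_fun [set: sigma J] X2.
Proof.
move=> JW1 JW2 JU.
apply: (@measurable_fun_fin _ _ _ (sigma J) _ _ _ W f2 U2) => //.
  by move=> k; exact: block_W.
by apply: (measurable_fun_rv_block ET JU); rewrite EU2.
Qed.

Let block_tnth J i (X : Om -> N.-tuple R) :
  measurable_fun [set: sigma J] X ->
  measurable_fun [set: sigma J] (fun w => tnth (X w) i).
Proof. by move=> mX; exact: (measurableT_comp (measurable_tnth i) mX). Qed.

Let block_xs (J : pred ('I_4 + ('I_N + 'I_N))) :
  J iW1 -> J iW2 -> J iU1 -> J iU2 ->
  measurable_fun [set: sigma J] xs.
Proof.
move=> JW1 JW2 JU1 JU2.
apply: (@measurable_fun_mktuple _ _ (sigma J) _ _
  (fun i w => tnth (X1 w) i + tnth (X2 w) i)) => i.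
apply: measurable_funD; apply: block_tnth; [exact: block_X1|exact: block_X2].
Qed.

Let mrcv : measurable_fun setT rcv.
Proof.
apply: (measurable_fun_mktuple (f := fun i (q : N.-tuple R * N.-tuple (R * R)) =>
  tnth q.1 i + (tnth q.2 i).1)) => i.
apply: measurable_funD.
  exact: (measurableT_comp (measurable_tnth i)).
apply: (measurableT_comp measurable_fst).
exact: (measurableT_comp (measurable_tnth i)).
Qed.

Let meve : measurable_fun setT eve.
Proof.
apply: (measurable_fun_mktuple (f := fun i (q : N.-tuple R * N.-tuple (R * R)) =>
  tnth q.1 i + (tnth q.2 i).1 + (tnth q.2 i).2)) => i.
apply: measurable_funD; first apply: measurable_funD.
- exact: (measurableT_comp (measurable_tnth i)).
- apply: (measurableT_comp measurable_fst).
  exact: (measurableT_comp (measurable_tnth i)).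
- apply: (measurableT_comp measurable_snd).
  exact: (measurableT_comp (measurable_tnth i)).
Qed.

Let rcvE w : rcv (xs w, noise eta1 eta2 w) = Y w.
Proof. by apply: eq_from_tnth => i; rewrite !tnth_mktuple. Qed.

Let eveE w : eve (xs w, noise eta1 eta2 w) = Z w.
Proof. by apply: eq_from_tnth => i; rewrite !tnth_mktuple. Qed.

Let mWT k : measurable (W @^-1` [set k]).
Proof. by apply: (sigma_block_measurable mE (J := predT)); exact: block_W. Qed.

Let fin_preimage d' (S : measurableType d') (V : S -> N.-tuple R) k :
  measurable_fun setT V -> measurable ((psi \o V) @^-1` [set k]).
Proof.
move=> mV; rewrite comp_preimage -[X in measurable X]setTI.
exact: mV.
Qed.

Let mY : measurable_fun setT Y.
Proof.
rewrite (_ : Y = rcv \o (fun w => (xs w, noise eta1 eta2 w))); last first.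
  by apply/funext => w; rewrite -rcvE.
apply: (measurableT_comp mrcv); apply: measurable_fun_pair.
  by apply: (measurable_fun_block mE (J := predT)); apply: block_xs.
apply: (measurable_fun_mktuple (f := fun i w => (eta1 i w, eta2 i w))) => i.
exact: measurable_fun_pair.
Qed.

Let mZ : measurable_fun setT Z.
Proof.
apply: (measurable_fun_mktuple (f := fun i w => tnth (Y w) i + eta2 i w)) => i.
apply: measurable_funD => //.
exact: (measurableT_comp (measurable_tnth i) mY).
Qed.

Let ok := [set w | psi (Y w) = W w].

Let mok : measurable ok.
Proof.
apply: (measurable_eq_fin (V := psi \o Y) (V' := W)) => // k.
exact: fin_preimage.
Qed.

Definition code_success : R := fine (P ok).

(* Decoding [W2] from a channel output that is independent of it succeeds with
   probability at most [1 / M2]. *)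
Let guess_W2 (V : Om -> N.-tuple R) (K := predC1 iW2) :
  measurable_fun [set: sigma K] V ->
  (P [set w | psi (V w) = W w] <= (M2%:R^-1)%:E)%E.
Proof.
move=> KV; have mV := measurable_fun_block mE KV.
set B := [set w | _].
have mB : measurable B.
  by apply: (measurable_eq_fin (V := psi \o V) (V' := W)) => // k; exact: fin_preimage.
(* On [W2 = k] correct decoding coincides with [C k], which no longer involves [W2] and is therefore
   independent of that event. *)
pose C k := [set w | psi (V w) = (W1 w, k)].
have mC k : measurable (C k : set (sigma K)).
  apply: (@measurable_eq_fin _ (sigma K) _ (psi \o V) (fun w => (W1 w, k))).
    by move=> l; exact: fin_preimage.
  case=> l m; have [->|km] := eqVneq k m.
    rewrite (_ : _ @^-1` _ = W1 @^-1` [set l]).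
      by apply: block_W1; rewrite /K /= iE.
    by apply/seteqP; split=> w /=; [case|move=> ->].
  rewrite (_ : _ @^-1` _ = set0); first exact: measurable0.
  by apply/seteqP; split=> w //= -[_ mk]; move: km; rewrite mk eqxx.
have mCT k : measurable (C k).
  by apply: (sigma_block_measurable mE (J := K)); exact: mC.
rewrite -(fineK (fin_num_measure P _ mB)) lee_fin (measure_fin_partition P mW2 mB).
have -> : \sum_k fine (P [set w | W2 w = k /\ B w]) =
    \sum_k M2%:R^-1 * fine (P (C k)).
  apply: eq_bigr => k _.
  rewrite (_ : [set w | _] = W2 @^-1` [set k] `&` C k); last first.
    by apply/seteqP; split=> w /= [<-]; rewrite /B /C /W /=.
  rewrite (block_indep mE EI ET indep (J := pred1 iW2) (K := K))//.
  - by rewrite lawW2 fineM// fin_num_measure.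
  - by move=> i /= ->.
  - by apply: block_W2; rewrite /= eqxx.
  - exact: mC.
rewrite -mulr_sumr ler_piMr ?invr_ge0//.
have mV2 k : measurable ((fun w => (psi (V w)).2) @^-1` [set k]).
  rewrite (_ : _ @^-1` _ = (psi \o V) @^-1` [set m | m.2 = k])//.
  apply: (fin_events_measurable (V := psi \o V)); last by exists [set m | m.2 = k].
  by move=> m; exact: fin_preimage.
(* Each [C k] forces the second decoded message to be [k], so these events are disjoint and their
   probabilities sum to at most one. *)
apply: (@le_trans _ _ (\sum_k fine (P [set w | (psi (V w)).2 = k /\ setT w]))).
  apply: ler_sum => k _; rewrite fine_le ?fin_num_measure//.
    by apply: measurableI (mV2 k) measurableT.
  apply: le_measure; rewrite ?inE//.
    by apply: measurableI (mV2 k) measurableT.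
  by move=> w; rewrite /C/= => ->.
by rewrite -measure_fin_partition// probability_setT.
Qed.

Let has_integral_eta1_sqr i : has_integral P (fun w => eta1 i w ^+ 2) (s1 ^+ 2).
Proof.
apply: ge0_has_integral => //; first by apply: measurable_funX.
  by move=> w; exact: sqr_ge0.
rewrite (integral_law (f := fun e => (e ^+ 2)%:E) (meta1 i) (law1 i)).
- exact: integral_normal_sqr.
- by apply/measurable_EFinP; exact: measurable_funX.
- by move=> e; rewrite lee_fin sqr_ge0.
Qed.

Let has_integral_eta2_sqr i : has_integral P (fun w => eta2 i w ^+ 2) (s2 ^+ 2).
Proof.
apply: ge0_has_integral => //; first by apply: measurable_funX.
  by move=> w; exact: sqr_ge0.
rewrite (integral_law (f := fun e => (e ^+ 2)%:E) (meta2 i) (law2 i)).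
- exact: integral_normal_sqr.
- by apply/measurable_EFinP; exact: measurable_funX.
- by move=> e; rewrite lee_fin sqr_ge0.
Qed.

Let Eeta1 j : rv_events (eta1 j) `<=` E (inr (inl j)). Proof. by []. Qed.
Let Eeta2 j : rv_events (eta2 j) `<=` E (inr (inr j)). Proof. by []. Qed.

(** Correct decoding with the noise as a separate argument, as [change_of_measure] requires. *)
Let okset : set (sigma src * N.-tuple (R * R)) :=
  [set q | psi (rcv (xs q.1, q.2)) = W q.1].

Let mxsq : measurable_fun setT
  (fun q : sigma src * N.-tuple (R * R) => (xs q.1, q.2)).
Proof.
apply: measurable_fun_pair => //; apply: (measurableT_comp (f := xs : sigma src -> _)) => //.
exact: block_xs.
Qed.

Let mWq k : measurable ((fun q : sigma src * N.-tuple (R * R) => W q.1) @^-1` [set k]).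
Proof.
have := @measurable_fst _ _ (sigma src) (N.-tuple (R * R)) measurableT
  (W @^-1` [set k] : set (sigma src)); rewrite setTI; apply.
exact: block_W.
Qed.

Let mokset : measurable okset.
Proof.
apply: (measurable_eq_fin (V := fun q : sigma src * N.-tuple (R * R) =>
  psi (rcv (xs q.1, q.2))) (V' := fun q => W q.1)) => // k.
by apply: fin_preimage; exact: (measurableT_comp mrcv mxsq).
Qed.

(** The residual [X2 - g * X1] is absorbed into Gaussian noise of standard deviation [t]. The sum is
    the expectation of [L], and the final [1] is [2 - 1], where [2] bounds the expectation of
    [T * expR (- L)]. *)
Lemma rate2_bound (g t : R) (r : 'I_N -> R) : 0 < t ->
  (forall i, has_integral P
     (fun w => (tnth (X2 w) i - g * tnth (X1 w) i) ^+ 2) (r i)) ->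
  code_success * ln M2%:R <=
  \sum_i (ln (t / s1) + ((2 * t ^+ 2)^-1 * (r i + s1 ^+ 2) - 2^-1)) + 1.
Proof.
move=> t0 hr; pose c := t / s1.
have c0 : 0 < c by rewrite divr_gt0.
have cs1 : c * s1 = t by rewrite divfK// gt_eqF.
(* Shifting the noise by [p] replaces [X2] by [g * X1] in the received sum. *)
pose p w := [tuple g * tnth (X1 w) i - tnth (X2 w) i | i < N].
pose A (x : R) (e : R * R) := (x + c * e.1, e.2).
pose l (x : R) (e : R * R) := normal_pdf x (c * s1) e.1 / normal_pdf 0 s1 e.1.
have mA : measurable_fun setT (fun q : R * (R * R) => A q.1 q.2).
  apply: measurable_fun_pair; last exact: (measurableT_comp measurable_snd).
  apply: measurable_funD => //; apply: measurable_funM => //.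
  exact: (measurableT_comp measurable_fst).
have me1 : measurable_fun setT (fun q : R * (R * R) => q.2.1).
  exact: (measurableT_comp measurable_fst).
have ml : measurable_fun setT (fun q : R * (R * R) => l q.1 q.2).
  by apply: measurable_normal_pdf_ratio => //; rewrite cs1.
have l0 x e : 0 <= l x e by rewrite divr_ge0// normal_pdf_ge0.
have mp : measurable_fun [set: sigma src] p.
  apply: (@measurable_fun_mktuple _ _ (sigma src) _ _
    (fun i w => g * tnth (X1 w) i - tnth (X2 w) i)) => i.
  apply: measurable_funB.
    by apply: measurable_funM => //; apply: block_tnth; exact: block_X1.
  by apply: block_tnth; exact: block_X2.
pose L w := \sum_i (ln (t / s1) + ((2 * t ^+ 2)^-1 * (eta1 i w - tnth (p w) i) ^+ 2
  - (2 * s1 ^+ 2)^-1 * eta1 i w ^+ 2)).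
have LE w : expR (- L w) = \prod_(i < N) l (tnth (p w) i) (eta1 i w, eta2 i w).
  rewrite /L -sumrN expR_sum; apply: eq_bigr => i _.
  by rewrite /l cs1 normal_pdf_ratioE//= addrA.
have hL : has_integral P L
    (\sum_i (ln (t / s1) + ((2 * t ^+ 2)^-1 * (r i + s1 ^+ 2) - 2^-1))).
  apply: has_integral_sum => i; apply: has_integralD; first exact: has_integral_cst.
  have h1 : has_integral P (fun w => (eta1 i w - tnth (p w) i) ^+ 2) (r i + s1 ^+ 2).
    have J : forall j, src j -> ~~ pred1 (inr (inl i) : 'I_4 + ('I_N + 'I_N)) j.
      by case.
    have mX : measurable_fun [set: sigma src]
        (fun w => tnth (X2 w) i - g * tnth (X1 w) i).
      apply: measurable_funB; first by apply: block_tnth; exact: block_X2.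
      by apply: measurable_funM => //; apply: block_tnth; exact: block_X1.
    have me : measurable_fun [set: sigma (pred1 (inr (inl i)))] (eta1 i).
      by apply: (measurable_eta1 ET Eeta1); rewrite /= eqxx.
    apply: (has_integral_ext (has_integral_normal_sqrD mE EI ET indep 1 J s10 mX me
      (law1 i) (hr i))); last by rewrite expr1n mul1r.
    by move=> w; rewrite tnth_mktuple; ring.
  apply: has_integral_ext (has_integralD (has_integralZ (2 * t ^+ 2)^-1 h1)
    (has_integralZ (- (2 * s1 ^+ 2)^-1) (has_integral_eta1_sqr i))) _ _.
    by move=> w; rewrite mulNr.
  by rewrite mulNr; congr (_ - _); field; rewrite gt_eqF.
pose T w := 1 + (M2%:R - 1) * \1_ok w : R.
have M2ge1 : 1 <= M2%:R :> R by rewrite ler1n.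
have Tge1 w : 1 <= T w by rewrite /T lerDl mulr_ge0// subr_ge0.
have mT : measurable_fun setT T.
  by apply: measurable_funD => //; apply: measurable_funM.
(* [F] dominates [T], which is [M2] on correct decoding and [1] otherwise: the indicator of an error
   is enlarged to the constant [1]. *)
pose F (q : sigma src * N.-tuple (R * R)) :=
  (M2%:R * \1_okset q + 1 : R)%:E.
have F0 q : (0 <= F q)%E by rewrite lee_fin addr_ge0// mulr_ge0.
have mF : measurable_fun setT F.
  by apply/measurable_EFinP; apply: measurable_funD => //; apply: measurable_funM.
have TK : (\int[P]_w (T w * expR (- L w))%:E <= 2%:E)%E.
  apply: (@le_trans _ _ (\int[P]_w (F (w, noise eta1 eta2 w) *
      (\prod_(i < N) l (tnth (p w) i) (eta1 i w, eta2 i w))%:E))%E).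
    have mexp : measurable_fun setT (fun w => expR (- L w)).
      apply: measurableT_comp => //; apply: measurableT_comp => //.
      by apply/measurable_EFinP; exact: (measurable_int P hL.1).
    apply: ge0_le_integral => //.
    - by move=> w _; rewrite lee_fin mulr_ge0 ?expR_ge0// ltW// (lt_le_trans _ (Tge1 w)).
    - by apply/measurable_EFinP; exact: measurable_funM.
    - apply: (eq_measurable_fun (fun w => (F (w, noise eta1 eta2 w) * (expR (- L w))%:E)%E)).
        by move=> w _; rewrite LE.
      apply: emeasurable_funM; last exact/measurable_EFinP.
      rewrite /F; apply/measurable_EFinP; apply: measurable_funD => //.
      apply: measurable_funM => //.
      rewrite (_ : (fun w => \1_okset (w, noise eta1 eta2 w)) = \1_ok)//.
      by apply/funext => w; rewrite !indicE; congr (nat_of_bool _)%:R;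
        apply: asbool_equiv_eq; rewrite /okset /ok/= rcvE.
    move=> w _; rewrite -LE -EFinM lee_fin ler_wpM2r ?expR_ge0//.
    rewrite /T (_ : \1_okset (w, noise eta1 eta2 w) = \1_ok w).
      by rewrite mulrBl mul1r addrC lerD2r gerBl.
    by rewrite !indicE; congr (nat_of_bool _)%:R;
      apply: asbool_equiv_eq; rewrite /okset /ok/= rcvE.
  rewrite -(change_of_measure mE EI ET indep Eeta1 Eeta2 law1 law2 mA ml l0 _ mp mF F0);
    last first.
    by move=> x G mG G0; exact: noise_integral_shift.
  (* The output under the test channel only involves [W1], [U1] and the noise, so [guess_W2] bounds
     the success probability by [1 / M2]. *)
  pose V w := [tuple (1 + g) * tnth (X1 w) i + c * eta1 i w | i < N].
  have KV : measurable_fun [set: sigma (predC1 iW2)] V.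
    apply: (@measurable_fun_mktuple _ _ (sigma (predC1 iW2)) _ _
      (fun i w => (1 + g) * tnth (X1 w) i + c * eta1 i w)) => i.
    apply: measurable_funD; apply: measurable_funM => //.
      by apply: block_tnth; apply: block_X1; rewrite /= iE.
    by apply: (measurable_eta1 ET Eeta1).
  set B := [set w | psi (V w) = W w].
  have mB : measurable B.
    apply: (measurable_eq_fin (V := psi \o V) (V' := W)) => // k.
    by apply: fin_preimage; exact: measurable_fun_block KV.
  rewrite [leLHS](_ : _ = \int[P]_w (M2%:R%:E * (\1_B w)%:E + 1))%E; last first.
    apply: eq_integral => w _; rewrite /F EFinD EFinM; congr (_ * _%:E + _)%E.
    rewrite !indicE; congr (nat_of_bool _)%:R; apply: asbool_equiv_eq.
    rewrite /okset /B/= (_ : rcv _ = V w)//.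
    by apply: eq_from_tnth => i; rewrite !tnth_mktuple/=; ring.
  have m1B : measurable_fun setT (fun w => (\1_B w : R)%:E) by exact/measurable_EFinP.
  have h0 w : setT w -> (0 <= M2%:R%:E * (\1_B w : R)%:E)%E by rewrite -EFinM lee_fin mulr_ge0.
  have hm := measurable_funeM M2%:R%:E m1B.
  rewrite ge0_integralD//.
  rewrite ge0_integralZl ?lee_fin//.
  rewrite integral_indic// setIT integral_cst//= probability_setT mule1.
  rewrite (_ : 2 = 1 + 1)// EFinD leeD2r//.
  apply: (@le_trans _ _ (M2%:R%:E * (M2%:R^-1)%:E)%E).
    by rewrite lee_wpmul2l// guess_W2.
  by rewrite -EFinM mulfV// pnatr_eq0 -lt0n.
have := integral_ln_le hL mT Tge1 TK.
have -> : (\int[P]_w (ln (T w))%:E = (code_success * ln M2%:R)%:E)%E.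
  transitivity (\int[P]_w ((ln M2%:R)%:E * (\1_ok w)%:E))%E.
    apply: eq_integral => w _; rewrite -EFinM /T indicE; case: (w \in ok).
      by rewrite !mulr1 subrKC.
    by rewrite !mulr0 addr0 ln1.
  rewrite ge0_integralZl ?lee_fin ?ln_ge0//; last exact/measurable_EFinP.
  rewrite integral_indic// setIT EFinM muleC /code_success fineK//.
  exact: fin_num_measure.
by rewrite lee_fin (_ : 2 - 1 = 1)//; lra.
Qed.

Let okE w : \1_okset (w, noise eta1 eta2 w) = \1_ok w :> R.
Proof.
rewrite !indicE; congr (nat_of_bool _)%:R.
by apply: asbool_equiv_eq; rewrite /okset /ok/= rcvE.
Qed.

Let msgs := ('I_M1 * 'I_M2)%type.

(* A quantization of the a posteriori probabilities of the messages given the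
   eavesdropper's observation under the test channel. *)
Let posterior (a c : R) (m : msgs) (z : N.-tuple R) : R :=
  fine (P [set w | psi [tuple a * tnth z i + c * eta1 i w | i < N] = m]).
Let level a c (z : N.-tuple R) : {ffun msgs -> 'I_(M1 * M2).+1} :=
  [ffun m => inord (Num.truncn ((M1 * M2)%:R * posterior a c m z))].
(** Levels are raised by one before normalization, so that every message keeps positive mass even
    when its posterior is rounded down to zero. *)
Let pmf_of (n : {ffun msgs -> 'I_(M1 * M2).+1}) (m : msgs) : R :=
  (n m).+1%:R / \sum_m' (n m').+1%:R.

Let M1M2_gt0 : 0 < (M1 * M2)%:R :> R.
Proof. by rewrite ltr0n muln_gt0 M10 M20. Qed.

Let sum_level_gt0 (n : {ffun msgs -> 'I_(M1 * M2).+1}) :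
  0 < \sum_m' (n m').+1%:R :> R.
Proof.
by rewrite (bigD1 (Ordinal M10, Ordinal M20))//= ltr_wpDr ?ltr0n ?sumr_ge0.
Qed.

Let pmf_of_gt0 n m : 0 < pmf_of n m.
Proof. by rewrite divr_gt0// ltr0n. Qed.

Let pmf_of_sum n : \sum_m pmf_of n m = 1.
Proof. by rewrite -mulr_suml mulfV// gt_eqF. Qed.

Let mtest (a c : R) : measurable_fun setT (fun q : N.-tuple R * Om =>
  [tuple a * tnth q.1 i + c * eta1 i q.2 | i < N]).
Proof.
apply: (measurable_fun_mktuple (f := fun i (q : N.-tuple R * Om) =>
  a * tnth q.1 i + c * eta1 i q.2)) => i.
apply: measurable_funD; apply: measurable_funM => //.
  exact: (measurableT_comp (measurable_tnth i)).
exact: (measurableT_comp (meta1 i)).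
Qed.

Let mtest1 (a c : R) z : measurable_fun setT (fun w =>
  [tuple a * tnth z i + c * eta1 i w | i < N]).
Proof. exact: (measurableT_comp (mtest a c) (pair1_measurable z)). Qed.

(** As a partial integral of the indicator of a measurable set of pairs, the posterior is measurable
    in [z] by Tonelli. *)
Let mpost a c m : measurable_fun setT (posterior a c m).
Proof.
pose D := [set q : N.-tuple R * Om |
  psi [tuple a * tnth q.1 i + c * eta1 i q.2 | i < N] = m].
have mD : measurable D by exact: (fin_preimage m (mtest a c)).
have mDi : measurable_fun setT (fun q => (\1_D q : R)%:E) by exact/measurable_EFinP.
have h := @measurable_fun_fubini_tonelli_F _ _ _ _ _ P _ mDi (fun q => ltac:(by rewrite lee_fin)).
rewrite (_ : posterior a c m = fine \o
    (fun z => \int[P]_w (\1_D (z, w) : R)%:E)%E).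
  by apply: (measurableT_comp _ h); exact: fine_measurable.
apply/funext => z /=; congr fine.
by rewrite -[X in P X]setIT -integral_indic//; exact: (fin_preimage m (mtest1 a c z)).
Qed.

Let post_ge0 a c m z : 0 <= posterior a c m z.
Proof. by rewrite fine_ge0. Qed.

Let post_sum a c z : \sum_m posterior a c m z = 1.
Proof.
have -> : 1 = fine (P setT) by rewrite probability_setT.
rewrite (measure_fin_partition P (V := psi \o (fun w => [tuple a * tnth z i + c * eta1 i w | i < N])))//.
  apply: eq_bigr => m _; rewrite /posterior; congr (fine (P _)).
  by apply/seteqP; split=> w /=; [|case].
by move=> m; exact: fin_preimage.
Qed.

Let post_le1 a c m z : posterior a c m z <= 1.
Proof.
rewrite -(post_sum a c z) (bigD1 m)//= lerDl.
by apply: sumr_ge0.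
Qed.

Let levelE a c m z :
  level a c z m = Num.truncn ((M1 * M2)%:R * posterior a c m z) :> nat.
Proof.
rewrite ffunE inordK// ltnS.
rewrite -(@ler_nat R); apply: (@le_trans _ _ ((M1 * M2)%:R * posterior a c m z)).
  by rewrite truncn_le mulr_ge0.
by rewrite ler_piMr.
Qed.

Let mlevel a c n : measurable (level a c @^-1` [set n]).
Proof.
rewrite (_ : _ @^-1` _ = \bigcap_(m in [set: msgs])
    ((fun z => (M1 * M2)%:R * posterior a c m z) @^-1`
       `[(n m)%:R, (n m).+1%:R[%classic)).
  apply: fin_bigcap_measurable; first exact: finite_finset.
  move=> m _.
  rewrite -[X in measurable X]setTI.
  exact: (measurable_funM (measurable_cst _) (mpost a c m)).
apply/seteqP; split=> z /=.
  move=> <- m _ /=; rewrite in_itv/= levelE; apply: truncn_itv.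
  by rewrite mulr_ge0.
move=> h; apply/ffunP => m; apply/val_inj; rewrite /= levelE.
by apply: truncn_def; have := h m Logic.I; rewrite /= in_itv.
Qed.

(** Rounding down keeps the total below [M1 * M2] times the mass one of the posterior; the
    increments contribute [M1 * M2] more. *)
Let sum_level_le a c z : \sum_m (level a c z m).+1%:R <= 2 * (M1 * M2)%:R :> R.
Proof.
apply: (@le_trans _ _ (\sum_m ((M1 * M2)%:R * posterior a c m z + 1))).
  apply: ler_sum => m _; rewrite -addn1 natrD lerD2r levelE.
  by rewrite truncn_le mulr_ge0.
rewrite big_split/= -mulr_sumr post_sum mulr1 sumr_const.
by rewrite card_prod !card_ord mulr_natl mulr2n.
Qed.

(** The increment compensates the rounding and the normalization costs a factor [2]. This controls
    [1 / q] on correct decoding. *)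
Let pmf_of_level_ge a c m z : posterior a c m z <= 2 * pmf_of (level a c z) m.
Proof.
rewrite /pmf_of mulrA ler_pdivlMr//.
apply: (@le_trans _ _ (posterior a c m z * (2 * (M1 * M2)%:R))).
  by rewrite ler_wpM2l.
rewrite mulrCA ler_pM2l// mulrC ltW// levelE; exact: truncnS_gt.
Qed.

(** The raised level is at least one. This controls [- ln q] on decoding errors. *)
Let pmf_of_level_min a c m z :
  (2 * (M1 * M2)%:R)^-1 <= pmf_of (level a c z) m.
Proof.
rewrite /pmf_of ler_pdivlMr// mulrC ler_pdivrMr ?mulr_gt0//.
apply: (le_trans (sum_level_le a c z)).
by rewrite ler_peMl// ?mulr_ge0// ler1n.
Qed.

Let pmf_of_le1 n m : pmf_of n m <= 1.
Proof.
rewrite -(pmf_of_sum n) (bigD1 m)//= lerDl.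
by apply: sumr_ge0 => m' _; exact: ltW.
Qed.

(** The sum is the expectation of [L] for the backward test channel. The constant [2] is [3 - 1],
    where [3] is the quantization factor [2] plus one for errors. The last term pays for decoding
    errors, on which [q] is only known to be at least [1 / (2 * M1 * M2)]. *)
Lemma equivocation_bound (a c k : R) (r : 'I_N -> R) : 0 < c -> 0 < k ->
  (forall i, has_integral P
     (fun w => (tnth (X1 w) i + tnth (X2 w) i) ^+ 2) (r i)) ->
  exists n (g : N.-tuple R -> 'I_n), (forall j, measurable (g @^-1` [set j])) /\
  ln 2 * disc_cond_entropy P W (g \o Z) <=
  \sum_i (ln c + ln k +
    (2 * (c * s1) ^+ 2)^-1 * ((1 - a) ^+ 2 * (r i + s1 ^+ 2) + a ^+ 2 * s2 ^+ 2)
    + (2 * (k * s2) ^+ 2)^-1 * (s1 ^+ 2 + s2 ^+ 2) - 1) + 2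
  + (1 - code_success) * ln (2 * (M1 * M2)%:R).
Proof.
move=> c0 k0 hr.
have cs0 : 0 < c * s1 by rewrite mulr_gt0.
have ks0 : 0 < k * s2 by rewrite mulr_gt0.
pose A (x : R) (e : R * R) :=
  let z := x + k * e.2 in let y := a * z + c * e.1 in (y - x, z - y).
pose l (x : R) (e : R * R) := let y := x + e.1 in let z := y + e.2 in
  (normal_pdf (a * z) (c * s1) y / normal_pdf 0 s1 e.1) *
  (normal_pdf x (k * s2) z / normal_pdf 0 s2 e.2).
have me1 : measurable_fun setT (fun q : R * (R * R) => q.2.1).
  exact: (measurableT_comp measurable_fst).
have me2 : measurable_fun setT (fun q : R * (R * R) => q.2.2).
  exact: (measurableT_comp measurable_snd).
have mz : measurable_fun setT (fun q : R * (R * R) => q.1 + k * q.2.2).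
  by apply: measurable_funD => //; exact: measurable_funM.
have my : measurable_fun setT
    (fun q : R * (R * R) => a * (q.1 + k * q.2.2) + c * q.2.1).
  by apply: measurable_funD; exact: measurable_funM.
have mA : measurable_fun setT (fun q : R * (R * R) => A q.1 q.2).
  by apply: measurable_fun_pair; exact: measurable_funB.
have my' : measurable_fun setT (fun q : R * (R * R) => q.1 + q.2.1).
  exact: measurable_funD.
have mz' : measurable_fun setT (fun q : R * (R * R) => q.1 + q.2.1 + q.2.2).
  exact: measurable_funD.
have ml : measurable_fun setT (fun q : R * (R * R) => l q.1 q.2).
  apply: measurable_funM; apply: measurable_normal_pdf_ratio => //.
  exact: measurable_funM.
have l0 x e : 0 <= l x e by rewrite mulr_ge0// divr_ge0// normal_pdf_ge0.
have mx : measurable_fun [set: sigma src] xs by exact: block_xs.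
(* The first square is [y - a * z] and the second is [z - x], both expressed in the input and the
   true noises. *)
pose L w := \sum_i (ln c + ln k +
   ((2 * (c * s1) ^+ 2)^-1 *
      ((1 - a) * tnth (xs w) i + (1 - a) * eta1 i w + (- a) * eta2 i w) ^+ 2
    + (2 * (k * s2) ^+ 2)^-1 * (eta1 i w + 1 * eta2 i w) ^+ 2
    + (- (2 * s1 ^+ 2)^-1) * eta1 i w ^+ 2
    + (- (2 * s2 ^+ 2)^-1) * eta2 i w ^+ 2)).
have LE w : expR (- L w) = \prod_(i < N) l (tnth (xs w) i) (eta1 i w, eta2 i w).
  rewrite /L -sumrN expR_sum; apply: eq_bigr => i _.
  rewrite /l !normal_pdf_ratioE//= -expRD !mulfK ?gt_eqF//.
  congr expR; ring.
have hL : has_integral P L (\sum_i (ln c + ln k +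
    (2 * (c * s1) ^+ 2)^-1 * ((1 - a) ^+ 2 * (r i + s1 ^+ 2) + a ^+ 2 * s2 ^+ 2)
    + (2 * (k * s2) ^+ 2)^-1 * (s1 ^+ 2 + s2 ^+ 2) - 1)).
  apply: has_integral_sum => i.
  have mxi : measurable_fun [set: sigma src] (fun w => (1 - a) * tnth (xs w) i).
    by apply: measurable_funM => //; exact: block_tnth.
  have h0 : has_integral P (fun w => ((1 - a) * tnth (xs w) i) ^+ 2) ((1 - a) ^+ 2 * r i).
    apply: has_integral_ext (has_integralZ ((1 - a) ^+ 2) (hr i)) _ _ => //.
    by move=> w; rewrite tnth_mktuple exprMn.
  have m1 : measurable_fun [set: sigma (pred1 (inr (inl i)))] (eta1 i).
    by apply: (measurable_eta1 ET Eeta1); rewrite /= eqxx.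
  have m2 : measurable_fun [set: sigma (pred1 (inr (inr i)))] (eta2 i).
    by apply: (measurable_eta2 ET Eeta2); rewrite /= eqxx.
  have J1 : forall j, src j -> ~~ pred1 (inr (inl i) : 'I_4 + ('I_N + 'I_N)) j by case.
  (* The moments are built by adding one noise at a time, each independent of what precedes it. *)
  have h1 := has_integral_normal_sqrD mE EI ET indep (1 - a) J1 s10 mxi m1 (law1 i) h0.
  pose J := predC1 (inr (inr i) : 'I_4 + ('I_N + 'I_N)).
  have J2 : forall j, J j -> ~~ pred1 (inr (inr i) : 'I_4 + ('I_N + 'I_N)) j by [].
  have mJ : measurable_fun [set: sigma J]
      (fun w => (1 - a) * tnth (xs w) i + (1 - a) * eta1 i w).
    apply: measurable_funD.
      by apply: (measurable_fun_sub_block (J := src)) mxi; case.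
    by apply: measurable_funM => //; exact: (measurable_eta1 ET Eeta1).
  have h2 := has_integral_normal_sqrD mE EI ET indep (- a) J2 s20 mJ m2 (law2 i) h1.
  have J3 : forall j, pred1 (inr (inl i)) j -> ~~ pred1 (inr (inr i) : 'I_4 + ('I_N + 'I_N)) j.
    by move=> j /eqP ->.
  have h3 := has_integral_normal_sqrD mE EI ET indep 1 J3 s20 m1 m2 (law2 i)
    (has_integral_eta1_sqr i).
  apply: has_integral_ext (has_integralD (has_integral_cst P (ln c + ln k))
    (has_integralD (has_integralD (has_integralD
      (has_integralZ (2 * (c * s1) ^+ 2)^-1 h2)
      (has_integralZ (2 * (k * s2) ^+ 2)^-1 h3))
      (has_integralZ (- (2 * s1 ^+ 2)^-1) (has_integral_eta1_sqr i)))
      (has_integralZ (- (2 * s2 ^+ 2)^-1) (has_integral_eta2_sqr i)))) _ _ => //.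
  by field; rewrite !gt_eqF.
(* Quantizers in [cond_entropy] take values in an ordinal, so the level functions are enumerated. *)
pose n := #|{: {ffun msgs -> 'I_(M1 * M2).+1}}|.
pose g z : 'I_n := enum_rank (level a c z).
exists n, g; split.
  move=> j; rewrite (_ : _ @^-1` _ = level a c @^-1` [set enum_val j])//.
  apply/seteqP; split=> z /=; first by move=> <-; rewrite enum_rankK.
  by rewrite /g => ->; rewrite enum_valK.
pose q (m : msgs) (v : 'I_n) := pmf_of (enum_val v) m.
pose S w := pmf_of (level a c (Z w)) (W w).
have mgZ v : measurable ((g \o Z) @^-1` [set v]).
  rewrite (_ : _ @^-1` _ = Z @^-1` (level a c @^-1` [set enum_val v])).
    by rewrite -[X in measurable X]setTI; exact: mZ.
  apply/seteqP; split=> z /=; first by move=> <-; rewrite enum_rankK.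
  by rewrite /g => ->; rewrite enum_valK.
have mlevelZ (h : {ffun msgs -> 'I_(M1 * M2).+1} -> msgs -> R) :
    measurable_fun setT (fun w => h (level a c (Z w)) (W w)).
  pose V w := (W w, level a c (Z w)).
  apply: (@measurable_fun_fin _ _ _ Om Om _ _ V (fun v _ => h v.2 v.1) idfun) => //;
    last exact: measurable_id.
  case=> m v; rewrite (_ : _ @^-1` _ = W @^-1` [set m] `&` Z @^-1` (level a c @^-1` [set v])).
    by apply: measurableI => //; rewrite -[X in measurable X]setTI; exact: mZ.
  by apply/seteqP; split=> w /=; rewrite /V; [case=> -> ->|case=> -> ->].
have mS : measurable_fun setT S by exact: mlevelZ.
have S0 w : 0 < S w by exact: pmf_of_gt0.
have S1 w : S w <= 1 by exact: pmf_of_le1.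
have entropy : ((ln 2 * disc_cond_entropy P W (g \o Z))%:E <=
    \int[P]_w (- ln (S w))%:E)%E.
  apply: le_trans (disc_cond_entropy_le P (q := q) mWT mgZ _ _) _.
  - by move=> m v; exact: pmf_of_gt0.
  - by move=> v; rewrite /q pmf_of_sum.
  - by rewrite le_eqVlt; apply/orP; left; apply/eqP; apply: eq_integral => w _;
      rewrite /q /S /g/= enum_rankK.
(* [T] is [1 / S] on correct decoding and [1] otherwise. *)
pose T w := 1 + ((S w)^-1 - 1) * \1_ok w : R.
have Tge1 w : 1 <= T w.
  by rewrite /T lerDl mulr_ge0// subr_ge0 invf_ge1.
have mT : measurable_fun setT T.
  apply: measurable_funD => //; apply: measurable_funM => //.
  apply: measurable_funB => //.
  exact: (mlevelZ (fun v m => (pmf_of v m)^-1)).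
pose F (p : sigma src * N.-tuple (R * R)) :=
  ((pmf_of (level a c (eve (xs p.1, p.2))) (W p.1))^-1 * \1_okset p + 1 : R)%:E.
have F0 p : (0 <= F p)%E.
  by rewrite lee_fin addr_ge0// mulr_ge0// invr_ge0 ltW.
have mF : measurable_fun setT F.
  apply/measurable_EFinP; apply: measurable_funD => //; apply: measurable_funM => //.
  pose V (p : sigma src * N.-tuple (R * R)) := (W p.1, level a c (eve (xs p.1, p.2))).
  apply: (@measurable_fun_fin _ _ _ _ _ _ _ V
    (fun v (_ : sigma src * N.-tuple (R * R)) => (pmf_of v.2 v.1)^-1) idfun) => //;
    last exact: measurable_id.
  case=> m v; rewrite (_ : _ @^-1` _ = (fun p : sigma src * N.-tuple (R * R) => W p.1) @^-1` [set m] `&`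
     (fun p : sigma src * N.-tuple (R * R) => eve (xs p.1, p.2)) @^-1` (level a c @^-1` [set v])).
    apply: measurableI; first exact: mWq.
    by rewrite -[X in measurable X]setTI; exact: (measurableT_comp meve mxsq).
  by apply/seteqP; split=> w /=; rewrite /V; [case=> -> ->|case=> -> ->].
have TK : (\int[P]_w (T w * expR (- L w))%:E <= 3%:E)%E.
  apply: (@le_trans _ _ (\int[P]_w (F (w, noise eta1 eta2 w) *
      (\prod_(i < N) l (tnth (xs w) i) (eta1 i w, eta2 i w))%:E))%E).
    have mexp : measurable_fun setT (fun w => expR (- L w)).
      apply: measurableT_comp => //; apply: measurableT_comp => //.
      by apply/measurable_EFinP; exact: (measurable_int P hL.1).
    have FE w : F (w, noise eta1 eta2 w) = (T w + \1_ok w)%:E.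
      rewrite /F okE eveE -/(S w); congr EFin; rewrite /T; ring.
    apply: ge0_le_integral => //.
    - by move=> w _; rewrite lee_fin mulr_ge0 ?expR_ge0// ltW// (lt_le_trans _ (Tge1 w)).
    - by apply/measurable_EFinP; exact: measurable_funM.
    - apply: (eq_measurable_fun (fun w => ((T w + \1_ok w) * expR (- L w))%:E)).
        by move=> w _; rewrite LE FE -EFinM.
      apply/measurable_EFinP; apply: measurable_funM => //.
      exact: measurable_funD.
    move=> w _; rewrite -LE FE -EFinM lee_fin ler_wpM2r ?expR_ge0//.
    by rewrite lerDl.
  rewrite -(change_of_measure mE EI ET indep Eeta1 Eeta2 law1 law2 mA ml l0 _ mx mF F0);
    last first.
    by move=> x G mG G0; exact: noise_integral_backward.
  (* Under the test channel the eavesdropper sees [z'], and the decoder's input is [a * z'] plus a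
     multiple of the first noise, which is independent of the messages and of [z']. *)
  pose z' w := [tuple tnth (xs w) i + k * eta2 i w | i < N].
  pose e1 w := [tuple eta1 i w | i < N].
  pose K : pred ('I_4 + ('I_N + 'I_N)) := fun i => if i is inr (inl _) then true else false.
  pose J := predC K.
  have JK i : J i -> ~~ K i by [].
  have mz0 : measurable_fun [set: sigma J] z'.
    apply: (@measurable_fun_mktuple _ _ (sigma J) _ _
      (fun i w => tnth (xs w) i + k * eta2 i w)) => i.
    apply: measurable_funD; first by apply: block_tnth; exact: block_xs.
    by apply: measurable_funM => //; exact: (measurable_eta2 ET Eeta2).
  have mK : measurable_fun [set: sigma K] e1.
    apply: (@measurable_fun_mktuple _ _ (sigma K) _ _ (fun i w => eta1 i w)) => i.
    exact: (measurable_eta1 ET Eeta1).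
  have mid : measurable_fun [set: sigma J] (idfun : Om -> sigma J).
    exact: measurable_id.
  pose dec (p : sigma J * N.-tuple R) :=
    [tuple a * tnth (z' p.1) i + c * tnth p.2 i | i < N].
  have mdec : measurable_fun setT dec.
    apply: (measurable_fun_mktuple (f := fun i (p : sigma J * N.-tuple R) =>
      a * tnth (z' p.1) i + c * tnth p.2 i)) => i.
    apply: measurable_funD; apply: measurable_funM => //.
      apply: (measurableT_comp (measurable_tnth i)).
      exact: (measurableT_comp (f := z' : sigma J -> _)).
    exact: (measurableT_comp (measurable_tnth i)).
  have mWJ m : measurable ((fun p : sigma J * N.-tuple R => W p.1) @^-1` [set m]).
    have := @measurable_fst _ _ (sigma J) (N.-tuple R) measurableT
      (W @^-1` [set m] : set (sigma J)); rewrite setTI; apply.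
    exact: block_W.
  pose B := [set p : sigma J * N.-tuple R | psi (dec p) = W p.1].
  have mB : measurable B.
    apply: (measurable_eq_fin (V := psi \o dec) (V' := fun p => W p.1)) => // m.
    exact: fin_preimage.
  pose H (p : sigma J * N.-tuple R) :=
    ((pmf_of (level a c (z' p.1)) (W p.1))^-1 * \1_B p : R)%:E.
  have H0 p : (0 <= H p)%E.
    by rewrite lee_fin mulr_ge0// invr_ge0 ltW.
  have mH : measurable_fun setT H.
    apply/measurable_EFinP; apply: measurable_funM => //.
    pose V (p : sigma J * N.-tuple R) := (W p.1, level a c (z' p.1)).
    apply: (@measurable_fun_fin _ _ _ _ _ _ _ V
      (fun v (_ : sigma J * N.-tuple R) => (pmf_of v.2 v.1)^-1) idfun) => //;
      last exact: measurable_id.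
    case=> m v; rewrite (_ : _ @^-1` _ = (fun p : sigma J * N.-tuple R => W p.1) @^-1` [set m] `&`
      (fun p : sigma J * N.-tuple R => z' p.1) @^-1` (level a c @^-1` [set v])).
      apply: measurableI; first exact: mWJ.
      rewrite -[X in measurable X]setTI.
      by apply: (measurableT_comp (f := z' : sigma J -> _)).
    by apply/seteqP; split=> w /=; rewrite /V; [case=> -> ->|case=> -> ->].
  have mHw : measurable_fun setT (fun w => H (w, e1 w)).
    have me1T : measurable_fun setT e1 by exact: measurable_fun_block mK.
    have midT : measurable_fun setT (idfun : Om -> sigma J).
      exact: (measurable_fun_block mE mid).
    exact: (measurableT_comp mH (measurable_fun_pair midT me1T)).
  rewrite [leLHS](_ : _ = \int[P]_w (H (w, e1 w) + 1))%E; last first.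
    apply: eq_integral => w _; rewrite /F /H EFinD; congr (_%:E + _)%E.
    rewrite (_ : eve _ = z' w); last first.
      by apply: eq_from_tnth => i; rewrite !tnth_mktuple/=; ring.
    congr (_ * _); rewrite !indicE; congr (nat_of_bool _)%:R; apply: asbool_equiv_eq.
    rewrite /okset /B/= (_ : rcv _ = dec (w, e1 w))//.
    by apply: eq_from_tnth => i; rewrite !tnth_mktuple/=; ring.
  rewrite ge0_integralD// integral_cst//= probability_setT mule1.
  rewrite (_ : 3%:E = 2%:E + 1)%E; last by rewrite -EFinD; congr EFin; ring.
  rewrite leeD2r//.
  rewrite (@block_tonelli _ _ _ _ _ _ mE EI ET indep _ _ (sigma J) _
    J K idfun e1 H JK mid mK mH H0).
  rewrite -[leRHS]mule1 -(probability_setT P) -integral_cst//.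
  apply: ge0_le_integral => //.
  - by move=> w _; exact: integral_ge0.
  - have me1T : measurable_fun setT e1 by exact: measurable_fun_block mK.
    apply: (measurable_fun_block mE (J := J)).
    apply: (@measurable_fun_fubini_tonelli_F _ _ (sigma J) Om R P
      (fun p => H (p.1, e1 p.2))) => //.
    apply: (measurableT_comp mH); apply: measurable_fun_pair => //.
    exact: (measurableT_comp me1T).
  move=> w _ /=.
  (* With the messages and [z'] frozen, the probability that the decoder outputs the true pair is by
     definition its posterior; its quotient by the quantized mass is at most [2]. *)
  have -> : (\int[P]_w' H (w, e1 w') =
     ((pmf_of (level a c (z' w)) (W w))^-1 * posterior a c (W w) (z' w))%:E)%E.
    set D := [set w' | psi [tuple a * tnth (z' w) i + c * eta1 i w' | i < N] = W w].
    have mD : measurable D by exact: (fin_preimage (W w) (mtest1 a c (z' w))).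
    transitivity (\int[P]_w' (((pmf_of (level a c (z' w)) (W w))^-1)%:E *
        (\1_D w' : R)%:E))%E.
      apply: eq_integral => w' _; rewrite -EFinM; congr (_ * _)%:E.
      rewrite !indicE; congr (nat_of_bool _)%:R; apply: asbool_equiv_eq.
      rewrite /B /D/= (_ : dec _ = [tuple a * tnth (z' w) i + c * eta1 i w' | i < N])//.
      by apply: eq_from_tnth => i; rewrite !tnth_mktuple.
    rewrite ge0_integralZl//; last 2 first.
    - exact/measurable_EFinP.
    - by rewrite lee_fin invr_ge0; exact/ltW/pmf_of_gt0.
    by rewrite integral_indic// setIT EFinM /posterior fineK// fin_num_measure.
  rewrite lee_fin mulrC ler_pdivrMr; first exact: pmf_of_level_ge.
  exact: pmf_of_gt0.
(* On correct decoding [T] is exactly [1 / S]; on an error the least possible mass is used. *)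
have lnS_le w : - ln (S w) <= ln (T w) + ln (2 * (M1 * M2)%:R) * \1_(~` ok) w.
  rewrite /T !indicE in_setC; case: (w \in ok) => /=.
    by rewrite mulr1 mulr0 addr0 subrKC lnV ?posrE.
  have M0 : 0 < 2 * (M1 * M2)%:R :> R by rewrite mulr_gt0.
  rewrite mulr0 addr0 ln1 add0r mulr1 lerNl -lnV ?posrE//.
  by rewrite ler_ln ?posrE ?invr_gt0//; exact: pmf_of_level_min.
have ln2M : 0 <= ln (2 * (M1 * M2)%:R) :> R.
  rewrite ln_ge0// mulr_ege1 ?ler1n//; by rewrite muln_gt0 M10.
have mlnT : measurable_fun setT (fun w => (ln (T w))%:E).
  by apply/measurable_EFinP; exact: measurableT_comp.
have mnok : measurable_fun setT (fun w => (\1_(~` ok) w : R)%:E).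
  by apply/measurable_EFinP/measurable_indic; exact: measurableC.
have mnok' := measurable_funeM (ln (2 * (M1 * M2)%:R))%:E mnok.
have lnT0 w : (0 <= (ln (T w))%:E)%E by rewrite lee_fin ln_ge0.
have nok0 w : (0 <= (ln (2 * (M1 * M2)%:R))%:E * (\1_(~` ok) w : R)%:E)%E.
  by rewrite -EFinM lee_fin mulr_ge0.
rewrite -lee_fin; apply: (le_trans entropy).
apply: (@le_trans _ _ (\int[P]_w ((ln (T w))%:E +
    (ln (2 * (M1 * M2)%:R))%:E * (\1_(~` ok) w : R)%:E))%E).
  apply: ge0_le_integral => //.
  - by move=> w _; rewrite lee_fin oppr_ge0 -[leRHS]ln1 ler_ln ?posrE.
  - by apply/measurable_EFinP; apply: measurableT_comp => //; exact: measurableT_comp.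
  - exact: emeasurable_funD.
  - by move=> w _; rewrite -EFinM -EFinD lee_fin.
have nokE : (\int[P]_w (\1_(~` ok) w : R)%:E = (1 - code_success)%:E)%E.
  rewrite integral_indic//; last exact: measurableC.
  transitivity (P (~` ok)); first by rewrite setIT.
  by rewrite probability_setC// EFinB /code_success fineK// fin_num_measure.
rewrite ge0_integralD// ge0_integralZl ?lee_fin// nokE.
rewrite -EFinM EFinD; apply: leeD; last by rewrite lee_fin mulrC.
have := integral_ln_le hL mT Tge1 TK.
by rewrite (_ : 3 - 1 = 2)//; ring.
Qed.

End code.

(** * From second moments of a code to the bounds with one correlation coefficient *)

Section converse.
Context {R : realType}.

(** Finiteness of the average forces each second moment to be finite, so that real moments can be
    named. *)
Lemma average_power d (Om : measurableType d) (P : probability Om R) (N : nat)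
    (x : 'I_N -> Om -> R) (p : R) : (0 < N)%N ->
  (forall i, measurable_fun setT (x i)) ->
  ((N%:R^-1)%:E * (\sum_(i < N) \int[P]_w ((x i w) ^+ 2)%:E) <= p%:E)%E ->
  exists a : 'I_N -> R, (forall i, has_integral P (fun w => x i w ^+ 2) (a i)) /\
    \sum_i a i <= N%:R * p.
Proof.
move=> N0 mx; pose S := (\sum_(i < N) \int[P]_w ((x i w) ^+ 2)%:E)%E.
have I0 i : (0 <= \int[P]_w ((x i w) ^+ 2)%:E)%E.
  by apply: integral_ge0 => w _; rewrite lee_fin sqr_ge0.
have N0' : 0 < N%:R^-1 :> R by rewrite invr_gt0 ltr0n.
rewrite -/S => Sp.
have Soo : (S < +oo)%E.
  rewrite ltey; apply/negP => /eqP SE; move: Sp.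
  by rewrite SE gt0_muley ?lte_fin// leye_eq.
have Ioo i : (\int[P]_w ((x i w) ^+ 2)%:E \is a fin_num)%E.
  rewrite ge0_fin_numE//; apply: le_lt_trans Soo.
  by rewrite /S (bigD1 i)//= leeDl// sume_ge0.
exists (fun i => fine (\int[P]_w ((x i w) ^+ 2)%:E)%E); split.
  move=> i; apply: ge0_has_integral; first exact: measurable_funX.
    by move=> w; exact: sqr_ge0.
  by rewrite fineK.
have SE : S = (\sum_i fine (\int[P]_w ((x i w) ^+ 2)%:E))%:E.
  by rewrite /S -sumEFin; apply: eq_bigr => i _; rewrite fineK.
by move: Sp; rewrite SE -EFinM lee_fin mulrC ler_pdivrMr ?ltr0n// mulrC.
Qed.

Lemma log2E (x : R) : ln 2 * log2 x = ln x.
Proof. by rewrite /log2 mulrC divfK// gt_eqF// ln_gt0// ltr1n. Qed.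

(** Both bounds are in nats and for the whole block. The same [rho] serves twice because both
    residual powers depend on the cross moments only through their average [C]. *)
Lemma code_converse (P1 P2 s1 s2 : R) (N M1 M2 : nat) (R1 R2 eps : R) :
  0 < P1 -> 0 < P2 -> 0 < s1 -> 0 < s2 -> (0 < N)%N -> (0 < M1)%N -> (0 < M2)%N ->
  gmac_dms_code P1 P2 s1 s2 N M1 M2 R1 R2 eps ->
  exists rho : R, [/\ -1 <= rho <= 1,
    (1 - eps) * ln M2%:R <= N%:R * (2^-1 * ln (1 + (1 - rho ^+ 2) * P2 / s1 ^+ 2)) + 1 &
    ln 2 * (N%:R * (R1 + R2 - eps)) <=
      N%:R * (2^-1 * ln (1 + (P1 + P2 + 2 * Num.sqrt (P1 * P2) * rho) / s1 ^+ 2)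
        - 2^-1 * ln (1 + (P1 + P2 + 2 * Num.sqrt (P1 * P2) * rho)
                           / (s1 ^+ 2 + s2 ^+ 2)))
      + 2 + eps * ln (2 * (M1 * M2)%:R)].
Proof.
move=> P10 P20 s10 s20 N0 M10 M20.
case=> d [Om [P [d1 [T1 [d2 [T2 [f1 [f2 [psi [W1 [W2 [U1 [U2 [eta1 [eta2]]]]]]]]]]]]]]].
move=> /= [[mW1 [mW2 [lawW1 lawW2]]] [mU1 mU2 mf1 mf2] [meta lawe] indep].
move=> [mpsi [pow1 pow2] perr equiv].
have meta1 i := (meta i).1; have meta2 i := (meta i).2.
have law1 i B mB := (lawe i B mB).1; have law2 i B mB := (lawe i B mB).2.
have mW k : measurable ((fun w => (W1 w, W2 w)) @^-1` [set k]).
  case: k => k l; rewrite (_ : _ @^-1` _ = W1 @^-1` [set k] `&` W2 @^-1` [set l]).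
    exact: measurableI.
  by apply/seteqP; split=> w /=; [case=> -> ->|case=> -> ->].
pose X1 w := f1 (W1 w) (U1 w); pose X2 w := f2 (W1 w, W2 w) (U2 w).
have mX1 : measurable_fun setT X1 by exact: measurable_fun_fin.
have mX2 : measurable_fun setT X2.
  exact: (measurable_fun_fin (W := fun w => (W1 w, W2 w))).
have mx1 i : measurable_fun setT (fun w => tnth (X1 w) i).
  exact: (measurableT_comp (measurable_tnth i)).
have mx2 i : measurable_fun setT (fun w => tnth (X2 w) i).
  exact: (measurableT_comp (measurable_tnth i)).
have [a [ha aP]] := average_power N0 mx1 pow1.
have [b [hb bP]] := average_power N0 mx2 pow2.
have /choice[c hc] : forall i, exists t,
    has_integral P (fun w => tnth (X1 w) i * tnth (X2 w) i) t.
  by move=> i; exact: has_integral_mul (ha i) (hb i).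
have Nr0 : 0 < N%:R :> R by rewrite ltr0n.
(* [g] is the coefficient of the best linear estimate of [X2] from [X1] when [X1] has power [P1] and
   the cross moment is [C]. *)
pose C := (\sum_i c i) / N%:R; pose g := C / P1.
have CE : \sum_i c i = N%:R * C by rewrite /C mulrC divfK// gt_eqF.
pose Q := Num.sqrt (P1 * P2).
have Q0 : 0 < Q by rewrite sqrtr_gt0 mulr_gt0.
have Q2 : Q ^+ 2 = P1 * P2 by rewrite sqr_sqrtr// ltW// mulr_gt0.
pose rho := C / Q.
have rho2 : rho ^+ 2 * P2 = C ^+ 2 / P1.
  by rewrite /rho exprMn exprVn Q2; field; rewrite !gt_eqF.
have Qrho : Q * rho = C by rewrite /rho mulrC divfK// gt_eqF.
pose r2 i := b i + - (2 * g) * c i + g ^+ 2 * a i.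
have hr2 i : has_integral P (fun w => (tnth (X2 w) i - g * tnth (X1 w) i) ^+ 2) (r2 i).
  apply: has_integral_ext (has_integralD (has_integralD (hb i)
    (has_integralZ (- (2 * g)) (hc i))) (has_integralZ (g ^+ 2) (ha i))) _ _ => //.
  by move=> w; ring.
pose r1 i := a i + 2 * c i + b i.
have hr1 i : has_integral P (fun w => (tnth (X1 w) i + tnth (X2 w) i) ^+ 2) (r1 i).
  apply: has_integral_ext (has_integralD (has_integralD (ha i)
    (has_integralZ 2 (hc i))) (hb i)) _ _ => //.
  by move=> w; ring.
have r2_ge0 i : 0 <= r2 i.
  rewrite -lee_fin -(hr2 i).2; apply: integral_ge0 => w _.
  by rewrite lee_fin sqr_ge0.
have sum_r2 : \sum_i r2 i <= N%:R * ((1 - rho ^+ 2) * P2).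
  rewrite /r2 !big_split/= -!mulr_sumr CE.
  have -> : N%:R * ((1 - rho ^+ 2) * P2) =
      N%:R * P2 + - (2 * g) * (N%:R * C) + g ^+ 2 * (N%:R * P1).
    by rewrite mulrBl mul1r rho2 /g; field; rewrite gt_eqF.
  by rewrite lerD// ?lerD2r// ler_wpM2l// sqr_ge0.
have sum_r1 : \sum_i r1 i <= N%:R * (P1 + P2 + 2 * C).
  rewrite /r1 !big_split/= -!mulr_sumr CE; lra.
(* The average residual power is nonnegative and at most [(1 - rho ^ 2) * P2], which yields the
   Cauchy-Schwarz bound on [rho]. *)
have rho1 : rho ^+ 2 <= 1.
  have : 0 <= N%:R * ((1 - rho ^+ 2) * P2).
    by apply: le_trans sum_r2; exact: sumr_ge0.
  by rewrite pmulr_rge0// pmulr_lge0// subr_ge0.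
have rho_itv : -1 <= rho <= 1.
  by rewrite -ler_norml -(@ler_pXn2r _ 2)// ?nnegrE// expr1n real_normK ?num_real.
have succ : 1 - eps <= code_success P f1 f2 psi W1 W2 U1 U2 eta1.
  have mY : measurable_fun setT (fun w => [tuple tnth (X1 w) i + tnth (X2 w) i + eta1 i w | i < N]).
    apply: (measurable_fun_mktuple (f := fun i w => tnth (X1 w) i + tnth (X2 w) i + eta1 i w)) => i.
    by apply: measurable_funD => //; exact: measurable_funD.
  rewrite /code_success; set ok := [set w | _].
  have mok : measurable ok.
    apply: (measurable_eq_fin (V := fun w => psi [tuple tnth (X1 w) i + tnth (X2 w) i + eta1 i w | i < N]) (V' := fun w => (W1 w, W2 w))) => // k.
    by have := mY measurableT _ (mpsi k); rewrite setTI.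
  have Pok : P (~` ok) = (1 - fine (P ok))%:E.
    by rewrite probability_setC// EFinB fineK// fin_num_measure.
  have perr' : (P (~` ok) <= eps%:E)%E by exact: perr.
  by move: perr'; rewrite Pok lee_fin; lra.
have ln20 : 0 < ln 2 :> R by rewrite ln_gt0// ltr1n.
exists rho; split => //.
(* With residual plus noise variance as [t ^ 2], the quadratic part of the expectation of [L] is at
   most [N / 2], which the terms [- 1 / 2] cancel; only [N * ln (t / s1)] survives. *)
- pose t := Num.sqrt (s1 ^+ 2 + (1 - rho ^+ 2) * P2).
  have t2 : t ^+ 2 = s1 ^+ 2 + (1 - rho ^+ 2) * P2.
    by rewrite sqr_sqrtr// addr_ge0// ?sqr_ge0// mulr_ge0 ?subr_ge0 ?(ltW P20).
  have t20 : 0 < t ^+ 2.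
    by rewrite t2 ltr_pwDl ?exprn_gt0// mulr_ge0 ?subr_ge0 ?(ltW P20).
  have t0 : 0 < t by rewrite sqrtr_gt0 -t2.
  have := @rate2_bound R d Om P d1 T1 d2 T2 N M1 M2 f1 f2 psi W1 W2 U1 U2 eta1 eta2 s1 s2.
  move=> /(_ s10 M20 mW1 mW2 lawW2 mU1 mU2 mf1 mf2 meta1 meta2 law1 law2 indep mpsi g t r2 t0 hr2).
  have -> : 1 + (1 - rho ^+ 2) * P2 / s1 ^+ 2 = (t / s1) ^+ 2.
    by rewrite [RHS]exprMn [in RHS]exprVn t2; field; rewrite gt_eqF.
  rewrite lnXn ?divr_gt0// -[ln _ *+ 2]mulr_natl mulKf//.
  rewrite !big_split/= !sumr_const card_ord -mulr_sumr big_split/= sumr_const card_ord.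
  move=> H; apply: (@le_trans _ _ (code_success P f1 f2 psi W1 W2 U1 U2 eta1 * ln M2%:R)).
    by rewrite ler_wpM2r// ln_ge0// ler1n.
  apply: (le_trans H); rewrite lerD2r.
  rewrite -(mulr_natl (ln _) N) -(mulr_natl (s1 ^+ 2) N) -(mulr_natl (- _) N) gerDl.
  have : (2 * t ^+ 2)^-1 * (\sum_i r2 i + N%:R * s1 ^+ 2) <=
         (2 * t ^+ 2)^-1 * (N%:R * t ^+ 2).
    rewrite ler_pM2l ?invr_gt0 ?mulr_gt0// t2; lra.
  have -> : (2 * t ^+ 2)^-1 * (N%:R * t ^+ 2) = N%:R / 2 by field; rewrite gt_eqF.
  lra.
(* [v] is the variance of [Y] at full power with cross moment [C]. *)
- pose v := s1 ^+ 2 + (P1 + P2 + 2 * C).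
  have PC : 0 <= P1 + P2 + 2 * C.
    have C2 : C ^+ 2 <= P1 * P2.
      by rewrite -Qrho exprMn Q2 ler_piMr// ltW// mulr_gt0.
    rewrite leNgt; apply/negP => h; have PP : 0 < P1 + P2 by rewrite addr_gt0.
    have : 0 < (- (2 * C) - (P1 + P2)) * (- (2 * C) + (P1 + P2)).
      by rewrite mulr_gt0//; lra.
    have := sqr_ge0 (P1 - P2); nra.
  have s12 : 0 < s1 ^+ 2 by rewrite exprn_gt0.
  have s22 : 0 < s2 ^+ 2 by rewrite exprn_gt0.
  have v0 : 0 < v by rewrite ltr_pwDl.
  have vs0 : 0 < v + s2 ^+ 2 by rewrite addr_gt0.
  have ss0 : 0 < s1 ^+ 2 + s2 ^+ 2 by rewrite addr_gt0.
  (* For jointly Gaussian outputs of variances [v] and [v + s2 ^ 2], [al] is the coefficient of the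
     linear estimate of [Y] from [Z] and [tau ^ 2] is its error variance. *)
  pose al := v / (v + s2 ^+ 2).
  pose tau := Num.sqrt (v * s2 ^+ 2 / (v + s2 ^+ 2)).
  have tau2 : tau ^+ 2 = v * s2 ^+ 2 / (v + s2 ^+ 2).
    by rewrite sqr_sqrtr// divr_ge0// ?mulr_ge0 ?sqr_ge0// ltW.
  have tau0 : 0 < tau by rewrite sqrtr_gt0 divr_gt0// mulr_gt0.
  (* With this [k], the test channel gives [Z] its true conditional variance [s1 ^ 2 + s2 ^ 2] given
     the input. *)
  pose k := Num.sqrt (s1 ^+ 2 + s2 ^+ 2) / s2.
  have ks2 : (k * s2) ^+ 2 = s1 ^+ 2 + s2 ^+ 2.
    by rewrite /k divfK ?gt_eqF// sqr_sqrtr// ltW.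
  have k0 : 0 < k by rewrite divr_gt0// sqrtr_gt0.
  have c0 : 0 < tau / s1 by rewrite divr_gt0.
  have := @equivocation_bound R d Om P d1 T1 d2 T2 N M1 M2 f1 f2 psi W1 W2 U1 U2 eta1 eta2 s1 s2.
  move=> /(_ s10 s20 M10 M20 mW1 mW2 mU1 mU2 mf1 mf2 meta1 meta2 law1 law2 indep mpsi al (tau / s1) k r1 c0 k0 hr1).
  move=> [n [q [mq]]].
  set H := disc_cond_entropy _ _ _ => Hle.
  (* The equivocation is an infimum over quantizers, so the one constructed from the posterior
     bounds it from above. *)
  have NH : N%:R * (R1 + R2 - eps) <= H.
    rewrite -ler_pdivlMl// -lee_fin EFinM; apply: (le_trans equiv).
    rewrite lee_wpmul2l ?lee_fin ?invr_ge0//.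
    by apply: ereal_inf_lbound; exists n, q.
  apply: (@le_trans _ _ (ln 2 * H)); first by rewrite ler_pM2l.
  apply: (le_trans Hle); apply: lerD.
    rewrite lerD2r.
    rewrite -[2 * Num.sqrt (P1 * P2) * rho]mulrA -/Q Qrho.
    have -> : 1 + (P1 + P2 + 2 * C) / s1 ^+ 2 = v / s1 ^+ 2.
      by rewrite /v; field; rewrite gt_eqF.
    have -> : 1 + (P1 + P2 + 2 * C) / (s1 ^+ 2 + s2 ^+ 2) = (v + s2 ^+ 2) / (s1 ^+ 2 + s2 ^+ 2).
      by rewrite /v; field; rewrite gt_eqF.
    have lnE : ln (tau / s1) + ln k =
        2^-1 * ln (v / s1 ^+ 2) - 2^-1 * ln ((v + s2 ^+ 2) / (s1 ^+ 2 + s2 ^+ 2)).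
      have : ln ((tau / s1 * k) ^+ 2) = ln (v / s1 ^+ 2) - ln ((v + s2 ^+ 2) / (s1 ^+ 2 + s2 ^+ 2)).
        rewrite -ln_div ?posrE ?divr_gt0//; congr ln.
        have -> : (tau / s1 * k) ^+ 2 = tau ^+ 2 * (k * s2) ^+ 2 / (s1 ^+ 2 * s2 ^+ 2).
          by field; rewrite !gt_eqF.
        by rewrite tau2 ks2; field; rewrite !gt_eqF.
      have tk0 : 0 < tau / s1 * k by rewrite mulr_gt0.
      have -> : ln (tau / s1) + ln k = ln (tau / s1 * k) by exact/esym/lnM.
      rewrite (lnXn 2 tk0) -(mulr_natl (ln _) 2) -mulrBr => <-.
      by rewrite mulKf.
    rewrite -lnE divfK ?gt_eqF// ks2.
    rewrite (eq_bigr (fun i => (2 * tau ^+ 2)^-1 * (1 - al) ^+ 2 * r1 i +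
      (ln (tau / s1) + ln k + (2 * tau ^+ 2)^-1 * ((1 - al) ^+ 2 * s1 ^+ 2 + al ^+ 2 * s2 ^+ 2)
       - 2^-1))); last first.
      by move=> i _; field; rewrite !gt_eqF.
    rewrite big_split/= -mulr_sumr sumr_const card_ord -[X in _ + X <= _]mulr_natl.
    (* Since the coefficient of [r1] is nonnegative, its sum may be replaced by the power bound. The
       quadratic terms then match exactly, because [(1 - al) ^ 2 * v + al ^ 2 * s2 ^ 2 = tau ^
       2]. *)
    apply: (@le_trans _ _ ((2 * tau ^+ 2)^-1 * (1 - al) ^+ 2 * (N%:R * (P1 + P2 + 2 * C)) +
      N%:R * (ln (tau / s1) + ln k + (2 * tau ^+ 2)^-1 *
        ((1 - al) ^+ 2 * s1 ^+ 2 + al ^+ 2 * s2 ^+ 2) - 2^-1))).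
      by rewrite lerD2r ler_wpM2l// mulr_ge0 ?sqr_ge0// invr_ge0 mulr_ge0// sqr_ge0.
    rewrite (_ : P1 + P2 + 2 * C = v - s1 ^+ 2); last by rewrite /v; ring.
    rewrite le_eqVlt; apply/orP; left; apply/eqP.
    rewrite tau2 /al; field.
    by rewrite !gt_eqF.
  rewrite ler_wpM2r//; last lra.
  by rewrite ln_ge0// mulr_ege1 ?ler1n// muln_gt0 M10.
Qed.

End converse.

(** * Passage to the limit in the block length *)

Theorem theorem7 (R : realType) (P1 P2 s1 s2 : R) :
  0 < P1 -> 0 < P2 -> 0 < s1 -> 0 < s2 ->
  forall R1 R2 : R, achievable_gmac_dms P1 P2 s1 s2 R1 R2 ->
    gmac_dms_outer P1 P2 s1 s2 R1 R2.
Proof.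
move=> P10 P20 s10 s20 R1 R2 ach.
have ln20 : 0 < ln 2 :> R by rewrite ln_gt0// ltr1n.
pose S (rho : R) := P1 + P2 + 2 * Num.sqrt (P1 * P2) * rho.
pose I2 (rho : R) := 2^-1 * ln (1 + (1 - rho ^+ 2) * P2 / s1 ^+ 2).
pose I12 (rho : R) := 2^-1 * ln (1 + S rho / s1 ^+ 2)
   - 2^-1 * ln (1 + S rho / (s1 ^+ 2 + s2 ^+ 2)).
(* A nonnegative [slack], measured in nats, means that both constraints hold at [rho]; its maximizer
   depends on no particular code. *)
pose slack (rho : R) := Num.min (I2 rho - ln 2 * R2) (I12 rho - ln 2 * (R1 + R2)).
have s12 : 0 < s1 ^+ 2 by rewrite exprn_gt0.
have s22 : 0 < s2 ^+ 2 by rewrite exprn_gt0.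
(* Any single code shows this: a rate is the logarithm of a positive integer over the block
   length. *)
have rate0 : 0 <= R1 /\ 0 <= R2.
  have [N0 /(_ N0.+1 (leqnSn _))] := ach 1 ltr01.
  move=> [M1 [M2 [M10 M20 <- <- _]]].
  by split; rewrite divr_ge0// /log2 divr_ge0 ?ln_ge0// ?ler1n// ltW.
have [R10 R20] := rate0.
have S_ge0 rho : -1 <= rho -> 0 <= S rho.
  move=> rho1; have Q0 := sqrtr_ge0 (P1 * P2).
  have Q2 : Num.sqrt (P1 * P2) ^+ 2 = P1 * P2.
    by rewrite sqr_sqrtr// ltW// mulr_gt0.
  have PP : 0 < P1 + P2 by rewrite addr_gt0.
  have : Num.sqrt (P1 * P2) <= (P1 + P2) / 2.
    rewrite -(@ler_pXn2r _ 2)// ?nnegrE ?divr_ge0 ?(ltW PP)// Q2.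
    by have := sqr_ge0 (P1 - P2); nra.
  by rewrite /S; nra.
have arg1 rho : -1 <= rho <= 1 -> 0 < 1 + (1 - rho ^+ 2) * P2 / s1 ^+ 2.
  move=> rho1; rewrite ltr_pwDl// divr_ge0 ?(ltW s12)// mulr_ge0 ?(ltW P20)//.
  by rewrite subr_ge0 -[rho ^+ 2]real_normK ?num_real// expr_le1// ler_norml.
have arg2 rho s : 0 < s -> -1 <= rho <= 1 -> 0 < 1 + S rho / s.
  by move=> s0 /andP[rho1 _]; rewrite ltr_pwDl// divr_ge0 ?(ltW s0)// S_ge0.
(* On the interval all arguments of [ln] are positive, where [ln] is continuous. *)
have cslack : {within `[(-1), 1], continuous slack}.
  apply: continuous_in_subspaceT => rho; rewrite inE/= in_itv/= => rho1.
  have cid : {for rho, continuous (fun x : R => x)} by exact: cvg_id.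
  have cS : S x @[x --> rho] --> S rho.
    by apply: cvgD; [exact: cvg_cst|apply: cvgM; [exact: cvg_cst|exact: cvg_id]].
  have cln (f : R -> R) : f x @[x --> rho] --> f rho -> 0 < f rho ->
      (2^-1 * ln (f x)) @[x --> rho] --> 2^-1 * ln (f rho).
    move=> cf f0; apply: cvgM; first exact: cvg_cst.
    by apply: (cvg_comp _ _ cf); exact: continuous_ln.
  have cdiv s : (1 + S x / s) @[x --> rho] --> 1 + S rho / s.
    by apply: cvgD; [exact: cvg_cst|apply: cvgM => //; exact: cvg_cst].
  apply: (@continuous_min _ _ (fun x => I2 x - ln 2 * R2)
    (fun x => I12 x - ln 2 * (R1 + R2))).
    apply: cvgB; last exact: cvg_cst.
    apply: (cln (fun x => 1 + (1 - x ^+ 2) * P2 / s1 ^+ 2)); last exact: arg1.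
    apply: cvgD; first exact: cvg_cst.
    apply: cvgM; last exact: cvg_cst.
    apply: cvgM; last exact: cvg_cst.
    apply: cvgB; first exact: cvg_cst.
    exact: exprn_continuous.
  apply: cvgB; last exact: cvg_cst.
  apply: cvgB.
    by apply: (cln (fun x => 1 + S x / s1 ^+ 2)) => //; exact: arg2.
  apply: (cln (fun x => 1 + S x / (s1 ^+ 2 + s2 ^+ 2))) => //.
  by apply: arg2 => //; rewrite addr_gt0.
have le11 : -1 <= 1 :> R by lra.
have [rho rho_itv rhoM] := EVT_max le11 cslack.
suff slack0 : 0 <= slack rho.
  move: slack0; rewrite /slack le_min !subr_ge0 => /andP[h2 h12].
  exists rho; split => //.
    rewrite -(ler_pM2l ln20); apply: (le_trans h2).
    by rewrite mulrCA log2E.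
  rewrite -(ler_pM2l ln20); apply: (le_trans h12).
  by rewrite mulrBr (mulrCA (ln 2)) (mulrCA (ln 2) 2^-1) !log2E.
rewrite leNgt; apply/negP => slack_lt0.
pose dl := - slack rho; have dl0 : 0 < dl by rewrite oppr_gt0.
have D0 : 0 < ln 2 * (1 + R1 + R2) by rewrite mulr_gt0//; lra.
(* With this [eps], the terms proportional to both [eps] and [N] cost at most [dl / 4] per channel
   use in either bound. *)
pose eps := dl / (4 * (ln 2 * (1 + R1 + R2))).
have eps0 : 0 < eps by rewrite divr_gt0// mulr_gt0.
have epsE : eps * (ln 2 * (1 + R1 + R2)) = dl / 4.
  by rewrite /eps; field; rewrite !gt_eqF//; lra.
have [N0 hN0] := ach eps eps0.
(* Beyond [K] the additive constants, divided by [N], stay below [dl / 4]. *)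
pose K := 4 * (2 + eps * ln 2) / dl.
pose N := maxn N0 (Num.truncn K).+1.
have N_gt0 : (0 < N)%N by rewrite leq_max orbT.
have Nr0 : 0 < N%:R :> R by rewrite ltr0n.
have NK : 4 * (2 + eps * ln 2) < N%:R * dl.
  rewrite -ltr_pdivrMr//; apply: lt_le_trans (truncnS_gt K) _.
  by rewrite ler_nat leq_max leqnn orbT.
have [M1 [M2 [M10 M20 rate1 rate2 code]]] := hN0 N (leq_maxl _ _).
have lnM1 : ln M1%:R = ln 2 * (N%:R * R1).
  by rewrite -rate1 [N%:R * _]mulrC divfK ?gt_eqF// log2E.
have lnM2 : ln M2%:R = ln 2 * (N%:R * R2).
  by rewrite -rate2 [N%:R * _]mulrC divfK ?gt_eqF// log2E.
have [r [r_itv]] := code_converse P10 P20 s10 s20 N_gt0 M10 M20 code.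
rewrite lnM2 natrM !lnM ?posrE ?mulr_gt0 ?ltr0n// lnM1 lnM2 => h2 h12.
have e2 : eps * ln 2 * R2 <= dl / 4.
  by rewrite -epsE -mulrA ler_wpM2l ?(ltW eps0)// ler_wpM2l ?(ltW ln20)//; lra.
have e12 : eps * ln 2 * (1 + R1 + R2) = dl / 4 by rewrite -mulrA.
have Ne2 := ler_wpM2l (ltW Nr0) e2.
have Ne12 : N%:R * (eps * ln 2 * (1 + R1 + R2)) = N%:R * (dl / 4) by rewrite e12.
have el2 : 0 <= eps * ln 2 by rewrite mulr_ge0// ltW.
(* The losses total less than [dl / 2] per use, so the code's own coefficient [r] has slack above
   [- dl], against the maximality of [rho]. *)
have : slack r <= slack rho by apply: rhoM; rewrite in_itv/=.
apply/negP; rewrite -ltNge -[slack rho]opprK -/dl /slack lt_min; apply/andP; split.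
  rewrite -(ltr_pM2l Nr0) /I2; lra.
rewrite -(ltr_pM2l Nr0) /I12 /S; lra.
Qed.
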